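(* Let $K$ be a field, $S=K[x_1,\ldots,x_n]$, and let $I\subset S$ be a nonzero proper monomial ideal with $\operatorname{Ass}(S/I)=\{P_1,\ldots,P_s\}$ (the $P_i$ pairwise distinct). Then Stanley's conjecture holds for $I$, i.e. $\operatorname{sdepth}(I)\ge\operatorname{depth}(I)$, if $I$ satisfies one of the following: (1) $P_i\nsubseteq \sum_{1\le j\le s,\, j\neq i}P_j$ for all $i\in\{1,\ldots,s\}$; (2) $\operatorname{bigsize}(I)=1$; (3) $I$ is a lexsegment ideal.
   Context: Depth is taken with respect to the graded maximal ideal $\mathfrak m=(x_1,\ldots,x_n)$ of $S$, with ideals regarded as $S$-modules. An empty sum of ideals is the zero ideal. Stanley depth: let $M$ be a nonzero finitely generated multigraded ($\mathbb{Z}^n$-graded) $S$-module. For a homogeneous $z\in M$ and $Z\subseteq\{x_1,\ldots,x_n\}$, let $zK[Z]$ be the $K$-subspace of $M$ of all elements $zf$, $f\in K[Z]$; it is called a Stanley space of dimension $|Z|$ if it is a free $K[Z]$-module. A Stanley decomposition of $M$ is a presentation of $M$ as a finite direct sum (of $K$-vector spaces) of Stanley spaces $\mathcal{D}: M=\bigoplus_{i=1}^r z_iK[Z_i]$. Put $\operatorname{sdepth}\mathcal{D}=\min\{|Z_i| : i=1,\ldots,r\}$, and let $\operatorname{sdepth}(M)$ be the maximum of $\operatorname{sdepth}\mathcal{D}$ over all Stanley decompositions $\mathcal{D}$ of $M$. Stanley's conjecture for $M$ is the inequality $\operatorname{sdepth}(M)\ge\operatorname{depth}(M)$. Bigsize: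 let $I=\bigcap_{i=1}^s Q_i$ be an irredundant primary decomposition, where the $Q_i$ are monomial ideals and $Q_i$ is $P_i$-primary, with the $P_i$ pairwise distinct. Let $b=\operatorname{height}(\sum_{j=1}^s Q_j)$. Then $\operatorname{bigsize}(I)=a'+(n-b)-1$, where $a'$ is the minimum number $t$ (with $1\le t\le s$) such that for all $j_1<\cdots<j_t$ one has $\sqrt{\sum_{l=1}^t Q_{j_l}}=\sqrt{\sum_{j=1}^s Q_j}$. This depends only on $\operatorname{Ass}(S/I)$. Lexsegment ideals: let $\geq_{lex}$ be the lexicographical order on monomials induced by $x_1>\cdots>x_n$, let $d\ge2$ be an integer and $\mathcal{M}_d$ the set of monomials of degree $d$. For $u,v\in\mathcal{M}_d$ with $u\geq_{lex}v$, put $\mathcal{L}(u,v)=\{w\in\mathcal{M}_d\mid u\geq_{lex}w\geq_{lex}v\}$. A lexsegment ideal is an ideal generated by such a set $\mathcal{L}(u,v)$ for some $d\ge 2$ and such $u,v$. *)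

(* Defs.v *)
From HB Require Import structures.
From mathcomp Require Import all_boot all_order all_algebra.
From mathcomp Require Import boolp classical_sets.
From mathcomp Require Export mpoly.

Set Implicit Arguments.
Unset Strict Implicit.
Unset Printing Implicit Defensive.

Import GRing.Theory.

Local Open Scope classical_set_scope.
Local Open Scope ring_scope.

(* Both return the junk value 0 when the maximum (minimum) does not exist. This
   does not occur below for a nonzero proper monomial ideal of K[x_1, ..., x_n]:
   all the numbers involved are then bounded by n, or by the number of primary
   components, and the sets are nonempty. *)
Definition max_nat (A : set nat) : nat :=
  xget 0%N [set k | A k /\ forall j, A j -> (j <= k)%N].

Definition min_nat (A : set nat) : nat :=
  xget 0%N [set k | A k /\ forall j, A j -> (k <= j)%N].

Section Ideals.
Variable R : comNzRingType.
Implicit Types (I J P Q M : set R) (G : set R) (fs : seq R).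

Definition is_ideal I : Prop :=
  [/\ I 0, forall x y, I x -> I y -> I (x + y) & forall a x, I x -> I (a * x)].

Definition ideal_gen G : set R :=
  [set x | forall J, is_ideal J -> G `<=` J -> J x].

Definition ideal_sum (s : nat) (A : pred 'I_s) (P : 'I_s -> set R) : set R :=
  [set x | exists2 y : 'I_s -> R,
             forall j, A j -> P j (y j) & x = \sum_(j < s | A j) y j].

Definition radical I : set R := [set x | exists k : nat, I (x ^+ k)].

Definition prime_ideal P : Prop :=
  [/\ is_ideal P, ~ P 1 & forall x y, P (x * y) -> P x \/ P y].

Definition primary_ideal Q : Prop :=
  [/\ is_ideal Q, ~ Q 1 & forall x y, Q (x * y) -> Q x \/ radical Q y].

(* The associated primes of the module R / I: the prime ideals that are the
   annihilator (I : f) of the class of some f. *)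
Definition Ass I : set (set R) :=
  [set P | prime_ideal P /\ exists f, P = [set a | I (a * f)]].

Definition prime_height P : nat :=
  max_nat [set k | exists p : nat -> set R,
    [/\ forall i, (i <= k)%N -> prime_ideal (p i),
        forall i, (i < k)%N -> p i `<` p i.+1
      & p k = P]].

Definition height I : nat :=
  min_nat [set h | exists P,
    [/\ prime_ideal P, I `<=` P & h = prime_height P]].

(* (f_1, ..., f_r) M *)
Definition seq_mul fs M : set R :=
  [set y | exists2 x : nat -> R,
             forall j, M (x j) & y = \sum_(j < size fs) fs`_j * x j].

Definition regular_seq M fs : Prop :=
  (forall i, (i < size fs)%N -> forall x, M x ->
     seq_mul (take i fs) M (fs`_i * x) -> seq_mul (take i fs) M x)
  /\ seq_mul fs M <> M.

(* The depth with respect to the ideal J of the ideal M viewed as a module. *)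
Definition depth_wrt J M : nat :=
  max_nat [set k | exists fs,
    [/\ size fs = k, forall f, f \in fs -> J f & regular_seq M fs]].

Definition irredundant_primary_decomposition I (s : nat) (Q : 'I_s -> set R)
  : Prop :=
  [/\ forall i, primary_ideal (Q i),
      injective (fun i => radical (Q i)),
      I = \bigcap_(i in [set: 'I_s]) Q i
    & forall i, I <> \bigcap_(j in [set j | j != i]) Q j].

End Ideals.

Section MonomialIdeals.
Variables (K : fieldType) (n : nat).
Local Notation S := {mpoly K[n]}.
Implicit Types (I : set S) (z : S) (Z : {set 'I_n}).

Definition monomial_gen (G : set 'X_{1..n}) : set S :=
  ideal_gen [set 'X_[m] | m in G].

Definition monomial_ideal I : Prop := exists G, I = monomial_gen G.

Definition graded_maximal_ideal : set S := ideal_gen [set 'X_i | i in [set: 'I_n]].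

Definition depth I : nat := depth_wrt graded_maximal_ideal I.

Definition multihomogeneous z : Prop :=
  exists (c : K) (m : 'X_{1..n}), z = c *: 'X_[m].

(* The subalgebra K[Z]. *)
Definition subalg Z : set S :=
  [set f | forall m, m \in msupp f -> forall i, m i != 0%N -> i \in Z].

Definition zK_span z Z : set S := [set z * f | f in subalg Z].

(* The K[Z]-module zK[Z] is cyclic, so it is free (of rank 1) exactly when no
   nonzero element of K[Z] annihilates its generator. *)
Definition stanley_space I z Z : Prop :=
  [/\ I z, multihomogeneous z & forall f, subalg Z f -> z * f = 0 -> f = 0].

Definition stanley_decomposition I (r : nat) (z : 'I_r -> S)
    (Z : 'I_r -> {set 'I_n}) : Prop :=
  [/\ forall i, stanley_space I (z i) (Z i),
      I = ideal_sum predT (fun i => zK_span (z i) (Z i))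
    & forall h : 'I_r -> S, (forall i, zK_span (z i) (Z i) (h i)) ->
        \sum_i h i = 0 -> forall i, h i = 0].

(* As #|Z i| <= n, the unit n of minn does not affect the minimum. *)
Definition sdepth_decomp (r : nat) (Z : 'I_r -> {set 'I_n}) : nat :=
  \big[minn/n]_(i < r) #|Z i|.

Definition sdepth I : nat :=
  max_nat [set k | exists r (z : 'I_r -> S) (Z : 'I_r -> {set 'I_n}),
    stanley_decomposition I z Z /\ k = sdepth_decomp Z].

(* The t-element subsets T stand for the index sequences j_1 < ... < j_t. *)
Definition bigsize_a (s : nat) (Q : 'I_s -> set S) : nat :=
  min_nat [set t | (1 <= t <= s)%N /\ forall T : {set 'I_s}, #|T| = t ->
    radical (ideal_sum (mem T) Q) = radical (ideal_sum predT Q)].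

Definition bigsize_decomp (s : nat) (Q : 'I_s -> set S) : nat :=
  (bigsize_a Q + (n - height (ideal_sum predT Q)) - 1)%N.

(* Every decomposition Q gives the same value, so the choice made by xget is
   immaterial. *)
Definition bigsize I : nat :=
  xget 0%N [set k | exists s (Q : 'I_s -> set S),
    [/\ forall i, monomial_ideal (Q i), irredundant_primary_decomposition I Q
      & k = bigsize_decomp Q]].

(* u >=lex v, with x_1 > ... > x_n *)
Definition lex_ge (u v : 'X_{1..n}) : Prop :=
  u = v \/ exists i : 'I_n,
    (forall j : 'I_n, (j < i)%N -> u j = v j) /\ (v i < u i)%N.

Definition lexsegment (d : nat) (u v : 'X_{1..n}) : set 'X_{1..n} :=
  [set w | [/\ mdeg w = d, lex_ge u w & lex_ge w v]].

Definition lexsegment_ideal I : Prop :=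
  exists (d : nat) (u v : 'X_{1..n}),
    [/\ (2 <= d)%N, mdeg u = d, mdeg v = d, lex_ge u v
      & I = monomial_gen (lexsegment d u v)].

End MonomialIdeals.

(* Main.v *)
Require Import Defs.
From mathcomp Require Import all_boot all_order all_algebra.
From mathcomp Require Import boolp classical_sets.
From mathcomp Require Import fintype finset zify ring.

(** Write U for the set of exponents of the monomials in I.

    Depth is bounded above by a nonzero class in Koszul cohomology. Cut the
    variables into blocks, some of them marked singletons, and let N be large.
    If a monomial x^u times the product of the x_t^N, t running over the unmarked
    elements of any transversal of the blocks, lies in I, these monomials are the
    coefficients of a Koszul cocycle over the x_t^N whose degree is the number of
    blocks. Restricted to one transversal B it cannot be a coboundary of a cochain
    with coefficients in I if dropping any unmarked element of B takes the monomial
    out of I. A regular sequence on I inside the maximal ideal forces the cohomology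
    of I to vanish below its length ([koszul_acyclic]), so its length is at most
    the number of blocks ([regular_seq_size]).

    Stanley depth is bounded below by cutting U into orthants. If the fibres of U
    in the directions of a set Y of coordinates are closed under minima, they are
    translates of the orthant N^Y, and sdepth I is at least #|Y|. If moreover every
    fibre stays the same along some further coordinate, these rays can be chosen
    coherently and give one more dimension ([sdepth_ge_fibres]).

    In each case the two bounds meet. In case (1) choose a variable y_i lying in P_i
    and in no other P_j; take Y to be the y_i together with the variables that lie
    in no P_j, and one block around each y_i. In case (2), bigsize 1 forces a' <= 2: if W
    is the set of variables in the radicals of the primary components, any two of
    these radicals contain W between them. Either one of them contains W, and one
    block gives 1 + #|~: W| for both invariants, or every component misses a variable
    of W, every monomial outside I stays outside along such a variable, and two blocks
    give 2 + #|~: W|. In case (3) a common factor and unused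
    variables are absorbed in the complement of W; then either the ideal has a socle
    element over W and one block suffices, or u and v are so close that the rest of
    I is of the form x_i A + B, with A and B not involving x_i; then every monomial
    outside I stays outside along x_i or along the last variable, and an explicit
    monomial again provides two blocks. *)

Set Implicit Arguments.
Unset Strict Implicit.
Unset Printing Implicit Defensive.

Import GRing.Theory.
Local Open Scope ring_scope.

(** * Koszul cohomology and regular sequences *)

Section IdealFacts.
Variable R : comNzRingType.
Implicit Types (J M : set R) (fs : seq R).

Lemma ideal_sum_closed J : is_ideal J ->
  forall (A : finType) (P : pred A) (F : A -> R),
  (forall i, P i -> J (F i)) -> J (\sum_(i | P i) F i).
Proof. by case=> J0 JD _ A P F JF; apply: (big_ind J) => // i; apply: JF. Qed.

Lemma ideal_opp J x : is_ideal J -> J x -> J (- x).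
Proof. by case=> _ _ JM Jx; rewrite -mulN1r; apply: JM. Qed.

Lemma ideal_sub J x y : is_ideal J -> J x -> J y -> J (x - y).
Proof. by move=> idJ Jx Jy; case: (idJ) => _ JD _; apply: JD => //; apply: ideal_opp. Qed.

Lemma seq_mul_ideal fs M : is_ideal M -> is_ideal (seq_mul fs M).
Proof.
move=> [M0 MD MM]; split.
- by exists (fun=> 0) => //; rewrite big1 // => j _; rewrite mulr0.
- move=> _ _ [x Mx ->] [y My ->]; exists (fun j => x j + y j).
    by move=> j; apply: MD.
  by rewrite -big_split /=; apply: eq_bigr => j _; rewrite mulrDr.
- move=> a _ [x Mx ->]; exists (fun j => a * x j); first by move=> j; apply: MM.
  by rewrite mulr_sumr; apply: eq_bigr => j _; rewrite mulrCA.
Qed.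

Lemma seq_mul_nil M y : seq_mul [::] M y -> y = 0.
Proof. by case=> x _ ->; rewrite big_ord0. Qed.

Lemma seq_mul_rcons fs f M y : is_ideal M ->
  seq_mul (rcons fs f) M y <->
  exists e, M e /\ seq_mul fs M (y - f * e).
Proof.
move=> [M0 MD MM].
have sumE (x : nat -> R) : \sum_(j < size (rcons fs f)) (rcons fs f)`_j * x j
    = \sum_(j < size fs) fs`_j * x j + f * x (size fs).
  rewrite size_rcons big_ord_recr /= nth_rcons ltnn eqxx; congr (_ + _).
  by apply: eq_bigr => j _; rewrite nth_rcons ltn_ord.
split=> [[x Mx ->]|[e [Me [x Mx yE]]]].
  by exists (x (size fs)); split=> //; exists x => //; rewrite sumE addrK.
pose z j := if (j < size fs)%N then x j else e.
exists z; first by rewrite /z => j; case: ifP.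
rewrite sumE {2}/z ltnn; apply/eqP; rewrite -subr_eq yE; apply/eqP.
by apply: eq_bigr => j _; rewrite /z ltn_ord.
Qed.

End IdealFacts.

Section Koszul.
Variables (R : comNzRingType) (n : nat) (r : 'I_n -> nat) (g : 'I_n -> R).
Hypothesis r_inj : injective r.
Implicit Types (c e h : {set 'I_n} -> R) (T : {set 'I_n}) (a : 'I_n -> R).

Definition rank_in T t := #|[set s in T | (r s < r t)%N]|.

(** The value of a cochain at T is its coefficient on the wedge product of the
    basis vectors e_t, t in T, taken in the order of r. Keeping r arbitrary lets a
    later cocycle have all its coefficients with the same sign. *)
Definition koszul_diff c T :=
  \sum_(t in T) (-1) ^+ rank_in T t * (g t * c (T :\ t)).

Definition koszul_contract a c T :=
  \sum_(t | t \notin T) (-1) ^+ rank_in T t * (a t * c (t |: T)).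

Lemma rank_inU1 T s t : s \notin T ->
  rank_in (s |: T) t = ((r s < r t) + rank_in T t)%N.
Proof.
move=> sT; rewrite /rank_in; case: (boolP (r s < r t)%N) => st.
  rewrite (_ : [set _ in _ | _] = s |: [set x in T | (r x < r t)%N]).
    by rewrite cardsU1 inE (negPf sT).
  by apply/setP=> x; rewrite !inE; case: eqVneq => // ->; rewrite st.
rewrite add0n; apply: eq_card => x; rewrite !inE.
by case: eqVneq => [->|]; rewrite ?(negPf st) ?andbF.
Qed.

Lemma rank_inD1 T s t : s \in T ->
  rank_in T t = ((r s < r t) + rank_in (T :\ s) t)%N.
Proof. by move=> sT; rewrite -{1}(setD1K sT) rank_inU1 // !inE eqxx. Qed.

Lemma signr_lt s t : s != t ->
  (-1) ^+ (r s < r t)%N = - (-1) ^+ (r t < r s)%N :> R.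
Proof.
move=> st; have: r s != r t by apply: contraNneq st => /r_inj ->.
by case: (ltngtP (r s) (r t)) => // _ _; rewrite !(expr0, expr1, opprK).
Qed.

(** The two halves of the sum, cut along the order r, cancel each other; this is
    what makes the statement true in characteristic 2. *)
Lemma antisymmetric_sum T (F : 'I_n -> 'I_n -> R) :
  (forall s t, s \in T -> t \in T -> s != t -> F s t = - F t s) ->
  \sum_(t in T) \sum_(s in T | s != t) F t s = 0.
Proof.
move=> FN.
have split_lt t : \sum_(s in T | s != t) F t s =
    \sum_(s in T | (r s < r t)%N) F t s + \sum_(s in T | (r t < r s)%N) F t s.
  rewrite (bigID (fun s => (r s < r t)%N)) /=; congr (_ + _); apply: eq_bigl => s.
    by case: eqVneq => [->|_]; rewrite ?andbT // ltnn !andbF.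
  case: eqVneq => [->|st]; rewrite ?ltnn ?andbF ?andbT //= -leqNgt leq_eqVlt.
  by case: eqP => // /r_inj ts; rewrite ts eqxx in st.
rewrite (eq_bigr _ (fun t _ => split_lt t)) big_split /=.
rewrite [X in _ + X](exchange_big_dep (mem T)) /=; last by move=> ? ? _ /andP[].
rewrite -big_split /= big1 // => t tT.
rewrite [X in _ + X](eq_bigl (fun s => (s \in T) && (r s < r t)%N)); last first.
  by move=> s; rewrite tT.
rewrite -big_split /= big1 // => s /andP[sT st]; apply/eqP; rewrite addrC addr_eq0.
by apply/eqP/FN => //; apply: contraTneq st => ->; rewrite ltnn.
Qed.

Lemma koszul_diff_diff c T : koszul_diff (koszul_diff c) T = 0.
Proof.
rewrite /koszul_diff.
pose F t s := (-1) ^+ rank_in T t * (-1) ^+ rank_in (T :\ t) s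
  * (g t * g s * c (T :\ t :\ s)).
rewrite (eq_bigr (fun t => \sum_(s in T | s != t) F t s)) => [|t tT].
  apply: antisymmetric_sum => s t sT tT st; rewrite /F (rank_inD1 t sT).
  rewrite (rank_inD1 s tT) !exprD (signr_lt st) setDDl setUC -setDDl; ring.
rewrite !mulr_sumr (eq_bigl (fun s => (s \in T) && (s != t))) => [|s].
  by apply: eq_bigr => s _; rewrite /F; ring.
by rewrite !inE andbC.
Qed.

(** Contraction with a makes multiplication by the combination of the g_t with
    coefficients a_t null-homotopic. *)
Lemma koszul_homotopy a c T :
  koszul_diff (koszul_contract a c) T + koszul_contract a (koszul_diff c) T
  = (\sum_t a t * g t) * c T.
Proof.
pose F t s := (-1) ^+ rank_in T t * (-1) ^+ rank_in (T :\ t) s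
  * (g t * a s * c (s |: (T :\ t))).
pose G s t := (-1) ^+ rank_in T s * (-1) ^+ rank_in (s |: T) t
  * (a s * g t * c ((s |: T) :\ t)).
have signK k x y z : (-1) ^+ k * (x * ((-1) ^+ k * (y * z))) = y * x * z :> R.
  transitivity ((-1) ^+ (k + k) * (y * x * z)); first by rewrite exprD; ring.
  by rewrite addnn -mul2n exprM sqrrN !expr1n mul1r.
have -> : koszul_diff (koszul_contract a c) T = \sum_(t in T) (a t * g t * c T) +
    \sum_(t in T) \sum_(s | s \notin T) F t s.
  rewrite -big_split; apply: eq_bigr => t tT /=; rewrite /koszul_contract.
  rewrite (bigD1 t) /= ?setD11 // setD1K // (rank_inD1 t tT) ltnn add0n.
  rewrite !mulrDr; congr (_ + _).
    exact: signK.
  rewrite !mulr_sumr; apply: eq_big => [s|s _]; last first.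
    by rewrite /F (rank_inD1 t tT) ltnn add0n; ring.
  by rewrite !inE; case: eqVneq => [->|_]; rewrite ?tT ?andbT ?andbF.
have -> : koszul_contract a (koszul_diff c) T = \sum_(s | s \notin T) (a s * g s * c T) +
    \sum_(s | s \notin T) \sum_(t in T) G s t.
  rewrite -big_split; apply: eq_bigr => s sT /=; rewrite /koszul_diff.
  rewrite (bigD1 s) /= ?setU11 // setU1K // rank_inU1 // ltnn add0n.
  rewrite !mulrDr; congr (_ + _).
    by rewrite signK; ring.
  rewrite !mulr_sumr; apply: eq_big => [t|t _]; last by rewrite /G; ring.
  by rewrite !inE; case: eqVneq => [->|_]; rewrite ?andbT ?andbF // (negPf sT).
rewrite addrACA mulr_suml [in RHS](bigID (mem T)) /= -[RHS]addr0; congr (_ + _).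
rewrite exchange_big /= -big_split /= big1 // => s sT; rewrite -big_split /= big1 // => t tT.
have st : s != t by apply: contraNneq sT => ->.
rewrite /F /G (rank_inU1 _ sT) (rank_inD1 s tT) !exprD (signr_lt st).
have -> : (s |: T) :\ t = s |: (T :\ t).
  by apply/setP=> x; rewrite !inE; case: (eqVneq x s) => [->|]; rewrite ?st.
have := signK (r t < r s)%N 1 1 1; rewrite !mulr1 mul1r.
move: ((-1) ^+ (r t < r s)%N) => e ee; set X := c _.
transitivity (g t * a s * X * (-1) ^+ rank_in T t * (-1) ^+ rank_in (T :\ t) s
  * (1 - e * e)); first by ring.
by rewrite ee subrr mulr0.
Qed.

Lemma koszul_diffB c e T :
  koszul_diff (fun T => c T - e T) T = koszul_diff c T - koszul_diff e T.
Proof. by rewrite -sumrB; apply: eq_bigr => t _; ring. Qed.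

Lemma koszul_diffZ f c T : koszul_diff (fun T => f * c T) T = f * koszul_diff c T.
Proof. by rewrite mulr_sumr; apply: eq_bigr => t _; ring. Qed.

Lemma koszul_diff_ideal J c T : is_ideal J -> (forall T, J (c T)) ->
  J (koszul_diff c T).
Proof.
move=> idJ Jc; apply: ideal_sum_closed => // t _.
by case: (idJ) => _ _ JM; apply: (JM); apply: (JM); apply: Jc.
Qed.

Lemma koszul_contract_ideal J a c T : is_ideal J -> (forall T, J (c T)) ->
  J (koszul_contract a c T).
Proof.
move=> idJ Jc; apply: ideal_sum_closed => // t _.
by case: (idJ) => _ _ JM; apply: (JM); apply: (JM); apply: Jc.
Qed.

Variables (M : set R) (fs : seq R).
Hypothesis idM : is_ideal M.
Hypothesis fs_reg : forall i, (i < size fs)%N -> forall x, M x ->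
  seq_mul (take i fs) M (fs`_i * x) -> seq_mul (take i fs) M x.
Hypothesis fs_rad : forall i, (i < size fs)%N ->
  exists k a, fs`_i ^+ k = \sum_t a t * g t.

Let N j := seq_mul (take j fs) M.

(** A regular sequence kills low Koszul cohomology: below degree i, cocycles of
    M / (f_1, ..., f_j) M are coboundaries when i + j is at most the length of the
    sequence. Some power of f = f_(j+1) is null-homotopic. If f c is the coboundary
    of h modulo (f_1, ..., f_j) M, then h is a cocycle modulo one more element and in
    one degree less, so by induction it is a coboundary plus f e, and dividing by f
    shows that c is the coboundary of e. Congruences between cochains of M stand for
    equalities of cochains of the quotient, and the support condition stands for the
    degree. *)
Lemma koszul_acyclic i j c : (i + j <= size fs)%N ->
  (forall T, M (c T)) -> (forall T, (i <= #|T|)%N -> c T = 0) ->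
  (forall T, N j (koszul_diff c T)) ->
  exists e, [/\ forall T, M (e T), forall T, (i.-1 <= #|T|)%N -> e T = 0
    & forall T, N j (c T - koszul_diff e T)].
Proof.
have idN k : is_ideal (N k) by apply: seq_mul_ideal.
have N0 k : N k 0 by case: (idN k).
have M0 : M 0 by case: idM.
elim: i => [|i IHi] in j c * => lt_ij Mc c0 Nc.
  exists (fun=> 0); split=> // T; rewrite c0 // /koszul_diff big1 ?subrr // => t _.
  by rewrite !mulr0.
have ltj : (j < size fs)%N by apply: leq_trans lt_ij; rewrite addSn ltnS leq_addl.
set f := fs`_j.
(* Division by f: b is a coboundary as soon as f b is one. *)
have step b h : (forall T, M (b T)) -> (forall T, (i < #|T|)%N -> b T = 0) ->
    (forall T, N j (koszul_diff b T)) ->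
    (forall T, M (h T)) -> (forall T, (i <= #|T|)%N -> h T = 0) ->
    (forall T, N j (f * b T - koszul_diff h T)) ->
    exists e, [/\ forall T, M (e T), forall T, (i <= #|T|)%N -> e T = 0
      & forall T, N j (b T - koszul_diff e T)].
  move=> Mb b0 Nb Mh h0 Nh.
  have NS y : N j.+1 y <-> exists z, M z /\ N j (y - f * z).
    by rewrite /N (take_nth 0 ltj); apply: seq_mul_rcons.
  have [] := IHi j.+1 h _ Mh h0.
  - by rewrite addnS -addSn.
  - move=> T; apply/NS; exists (b T); split=> //.
    by rewrite -opprB; apply: ideal_opp.
  move=> b' [Mb' b'0 Nb'].
  have [e eP] : {e : {set 'I_n} -> R & forall T,
      [/\ M (e T), (i <= #|T|)%N -> e T = 0 & N j (h T - koszul_diff b' T - f * e T)]}.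
    apply: (@choice _ _ (fun T y => [/\ M y, (i <= #|T|)%N -> y = 0
      & N j (h T - koszul_diff b' T - f * y)])) => T.
    case: (leqP i #|T|) => [iT|_]; last first.
      by case/NS: (Nb' T) => z [Mz Nz]; exists z.
    exists 0; split=> //; rewrite mulr0 h0 // /koszul_diff big1 ?subrr // => t tT.
    rewrite b'0 ?mulr0 //.
    by have := cardsD1 t T; rewrite tT; lia.
  exists e; split=> [T|T|T]; [by case: (eP T)|by case: (eP T)|].
  apply: fs_reg => //.
    by apply: ideal_sub => //; apply: koszul_diff_ideal => // T'; case: (eP T').
  rewrite (_ : _ * _ = (f * b T - koszul_diff h T) +
     koszul_diff (fun T => h T - koszul_diff b' T - f * e T) T).
    by case: (idN j) => _ ND _; apply: ND => //; apply: koszul_diff_ideal => // T'; case: (eP T').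
  rewrite !koszul_diffB koszul_diff_diff koszul_diffZ -/f; ring.
have [k [a fk]] := fs_rad ltj.
have: exists h, [/\ forall T, M (h T), forall T, (i <= #|T|)%N -> h T = 0
    & forall T, N j (f ^+ k * c T - koszul_diff h T)].
  exists (koszul_contract a c); split=> [T|T iT|T].
  - exact: koszul_contract_ideal.
  - rewrite /koszul_contract big1 // => t tT; rewrite c0 ?mulr0 //.
    by rewrite cardsU1 tT.
  - rewrite fk -koszul_homotopy addrAC subrr add0r.
    exact: koszul_contract_ideal.
(* The factors of f ^+ k are divided out one at a time. *)
elim: k {fk} => [|k IHk] [h [Mh h0 Nh]].
  by exists h; split=> // T; have := Nh T; rewrite expr0 mul1r.
apply: IHk; apply: (step _ h) => // T.
- by case: idM => _ _ MM; apply: MM.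
- by move=> iT; rewrite c0 ?mulr0.
- by rewrite koszul_diffZ; case: (idN j) => _ _ NM; apply: NM.
- by rewrite mulrA -exprS.
Qed.

End Koszul.

(** * Monomial ideals through their exponents *)

Section MonomialIdeals.
Variables (K : fieldType) (n : nat).
Local Notation S := {mpoly K[n]}.
Implicit Types (I : set S) (m u : 'X_{1..n}) (U : 'X_{1..n} -> Prop).

Definition exps I m : Prop := I 'X_[m].

Definition upclosed U := forall m m', (m <= m')%MM -> U m -> U m'.

Definition supported_in U : set S := [set f | forall m, m \in msupp f -> U m].

Lemma supported_in_ideal U : upclosed U -> is_ideal (supported_in U).
Proof.
move=> upU; split=> [m|f h Uf Uh m|a f Uf m].
- by rewrite msupp0.
- by move/msuppD_le; rewrite mem_cat => /orP[/Uf|/Uh].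
- case/msuppM_le/allpairsP=> -[m1 m2] /= [_ m2f ->].
  by apply: upU (lem_addl _ _) _; apply: Uf.
Qed.

Lemma ideal_gen_ideal (R : comNzRingType) (G : set R) : is_ideal (ideal_gen G).
Proof.
split=> [J [] //|x y Ix Iy J idJ GJ|a x Ix J idJ GJ]; case: (idJ) => _ JD JM.
  by apply: JD; [apply: Ix|apply: Iy].
by apply: JM; apply: Ix.
Qed.

Lemma ideal_of_exps I f : is_ideal I ->
  (forall m, m \in msupp f -> exps I m) -> I f.
Proof.
move=> idI If; case: (idI) => I0 ID IM.
rewrite [f]mpolyE big_seq; apply: (big_ind I) => // m /If Im.
by rewrite -mul_mpolyC; apply: IM.
Qed.

Lemma monomial_idealE I : monomial_ideal I ->
  [/\ is_ideal I, upclosed (exps I) & forall f, I f <-> supported_in (exps I) f].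
Proof.
move=> [G ->]; set I' := @monomial_gen K n G.
have idI : is_ideal I' by apply: ideal_gen_ideal.
have upI : upclosed (exps I').
  move=> m m' mm' Im; rewrite /exps -(submK mm') mpolyXD.
  by case: idI => _ _; apply.
split=> // f; split=> [If|]; last exact: ideal_of_exps.
apply: If; first exact: supported_in_ideal.
move=> _ /= [m Gm <-] m'; rewrite msuppX inE => /eqP ->.
by move=> J idJ GJ; apply: GJ; exists m.
Qed.

Lemma mcoeffXM_lem m m' (f : S) : ('X_[m] * f)@_(m + m') = f@_m'.
Proof. by rewrite mulrC mcoeffMX. Qed.

Lemma mcoeffXM_eq0 m m' (f : S) : ~~ (m <= m')%MM -> ('X_[m] * f)@_m' = 0.
Proof.
move=> mm'; apply: memN_msupp_eq0; apply: contra mm'.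
rewrite mulrC (perm_mem (msuppMX _ _)) => /mapP[m1 _ ->]; exact: lem_addr.
Qed.

End MonomialIdeals.

Section Radical.
Variable R : comNzRingType.

Lemma radical_ideal (J : set R) : is_ideal J -> is_ideal (radical J).
Proof.
move=> idJ; case: (idJ) => J0 JD JM; split.
- by exists 1%N; rewrite expr1.
- move=> x y [k Jx] [l Jy]; exists (k + l)%N; rewrite exprDn.
  apply: ideal_sum_closed => // i _; rewrite -mulr_natl; apply: (JM).
  have Jpow z e e' : J (z ^+ e) -> (e <= e')%N -> J (z ^+ e').
    by move=> Jz ee; rewrite -(subnK ee) exprD; apply: JM.
  case: (leqP l i) => il; first by apply: (JM); apply: Jpow Jy il.
  by rewrite mulrC; apply: (JM); apply: Jpow Jx _; lia.
- by move=> a x [k Jx]; exists k; rewrite exprMn; apply: JM.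
Qed.

Lemma span_ideal n (g : 'I_n -> R) :
  is_ideal [set f | exists a, f = \sum_t a t * g t].
Proof.
split.
- by exists (fun=> 0); rewrite big1 // => t _; rewrite mul0r.
- move=> _ _ [a ->] [b ->]; exists (fun t => a t + b t).
  by rewrite -big_split; apply: eq_bigr => t _; rewrite mulrDl.
- move=> c _ [a ->]; exists (fun t => c * a t).
  by rewrite mulr_sumr; apply: eq_bigr => t _; rewrite mulrA.
Qed.

End Radical.

(** * An upper bound for depth *)

Section DepthBound.
Variables (K : fieldType) (n : nat).
Local Notation S := {mpoly K[n]}.
Implicit Types (I : set S) (m u : 'X_{1..n}) (T : {set 'I_n}).

(** The Koszul complex is taken over powers of the variables so that products of
    its coefficients reach ideals that are not radical; elements of the maximal
    ideal then have only a power in the ideal generated by these coefficients. *)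
Lemma graded_maximal_radical N (f : S) : graded_maximal_ideal (K:=K) (n:=n) f ->
  exists k a, f ^+ k = \sum_t a t * 'X_[U_(t) *+ N].
Proof.
have idJ := span_ideal (fun t : 'I_n => 'X_[U_(t) *+ N] : S).
move/(_ _ (radical_ideal idJ)) => []; last by move=> k [a fk]; exists k, a.
move=> _ [t _ <-]; exists N; exists (fun s => (s == t)%:R).
rewrite (bigD1 t) //= eqxx mul1r big1 => [|s /negPf ->]; last by rewrite mul0r.
by rewrite addr0 mpolyXn.
Qed.

Lemma depth_le I D :
  (forall fs, (forall f, f \in fs -> graded_maximal_ideal (K:=K) (n:=n) f) ->
    regular_seq I fs -> (size fs <= D)%N) ->
  (depth I <= D)%N.
Proof.
move=> leD; rewrite /depth /depth_wrt /max_nat.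
by case: xgetP => // k -> [[fs [<- fsJ fs_reg]] _]; apply: leD.
Qed.

(** The map p sends each variable to the representative of its block. The blocks of
    the elements of O are singletons, which contribute the factor 1 instead of
    x_t^N to the coefficients of the cocycle. *)
Variables (I : set S) (p : 'I_n -> 'I_n) (O : {set 'I_n}) (u : 'X_{1..n}) (N : nat).
Hypothesis I_mon : monomial_ideal I.
Hypothesis p_idem : forall t, p (p t) = p t.
Hypothesis O_single : forall t s, t \in O -> p s = p t -> s = t.
Hypothesis uO : forall t, t \in O -> (u t < N)%N.

Let B := [set t | p t == t].

Definition transversal T := [forall b in B, #|[set t in T | p t == b]| == 1%N].

Definition trans_mon T : 'X_{1..n} :=
  [multinom (u t + N * (t \in T :\: O))%N | t < n].

Hypothesis trans_in : forall T, transversal T -> exps I (trans_mon T).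
Hypothesis base_notin : forall b, b \in B -> b \notin O -> ~ exps I (trans_mon (B :\ b)).

Lemma trans_monD1 T t : t \in T -> t \notin O ->
  (U_(t) *+ N + trans_mon (T :\ t))%MM = trans_mon T.
Proof.
move=> tT tO; apply/mnmP=> s; rewrite mnmDE mulmnE mnm1E !mnmE !inE.
by case: (eqVneq s t) => [->|]; rewrite ?tT ?tO ?eqxx //=; lia.
Qed.

Lemma card_transversal T : transversal T -> #|T| = #|B|.
Proof.
move=> /forall_inP trT; rewrite -sum1_card (partition_big p (mem B)) /=; last first.
  by move=> t _; rewrite inE p_idem.
rewrite -sum1_card; apply: eq_bigr => b /trT /eqP cardb.
by rewrite -[RHS]cardb -sum1_card; apply: eq_bigl => t; rewrite inE.
Qed.

(** Variables are ordered block by block. *)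
Let rk (t : 'I_n) := (p t * n + t)%N.

Lemma rk_lt s t : (rk s < rk t)%N = (p s < p t)%N || (p s == p t) && (s < t)%N.
Proof.
rewrite /rk -[p s == p t]/(p s == p t :> nat).
have := ltn_ord s; have := ltn_ord t; case: (ltngtP (p s) (p t)) => /= [|| ->]; nia.
Qed.

Lemma rk_inj : injective rk.
Proof.
move=> s t st; have := rk_lt s t; have := rk_lt t s; rewrite st ltnn.
case: (ltngtP (p s) (p t)) => //= /val_inj ->; rewrite eqxx /=.
by case: (ltngtP s t) => // /val_inj.
Qed.

Let g t : S := 'X_[U_(t) *+ N].
Let c T : S := if transversal T then 'X_[trans_mon T] else 0.

Lemma transversalD1 T s t : s \in T -> t \in T -> p s = p t ->
  transversal (T :\ s) = transversal (T :\ t).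
Proof.
move=> sT tT st; apply: eq_forallb_in => b _.
have cnt x : x \in T -> #|[set t in T | p t == b]| =
   ((p x == b) + #|[set t in T :\ x | p t == b]|)%N.
  move=> xT; rewrite (cardsD1 x) inE xT /=; congr (_ + _)%N.
  by apply: eq_card => y; rewrite !inE andbA.
by have := cnt _ sT; rewrite (cnt _ tT) st => /addnI ->.
Qed.

(** The coboundary at T can only be nonzero if T is a transversal with one element
    too many. The two elements s and t of the crowded block are consecutive in T for
    the order rk, so removing one or the other gives opposite signs and, after
    multiplication by x_s^N or x_t^N, the same monomial. *)
Lemma trans_cocycle T : koszul_diff rk g c T = 0.
Proof.
case: (boolP [exists t in T, transversal (T :\ t)]) => [|no]; last first.
  rewrite /koszul_diff big1 // => t tT; rewrite /c ifN ?mulr0 //.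
  by apply: contra no => trt; apply/exists_inP; exists t.
case/exists_inP=> t0 t0T tr0; pose b := p t0.
have bB : b \in B by rewrite inE p_idem.
have: #|[set t in T | p t == b]| == 2%N.
  rewrite (cardsD1 t0) inE t0T eqxx /= add1n eqSS.
  rewrite -[X in _ == X](eqP (forall_inP tr0 b bB)); apply/eqP; apply: eq_card => y.
  by rewrite !inE andbA.
case/cards2P => s [t [st EB]].
wlog lt_st: s t st EB / (s < t)%N.
  move=> wl; case: (ltngtP s t) => [|ts|/val_inj E]; first exact: wl.
    by apply: (wl t s) => //; rewrite ?EB 1?eq_sym // setUC.
  by rewrite E eqxx in st.
have [/andP[sT /eqP ps] /andP[tT /eqP pt]] : (s \in T) && (p s == b) /\ (t \in T) && (p t == b).
  have /setP E := EB; split; first by have := E s; rewrite !inE eqxx.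
  by have := E t; rewrite !inE eqxx orbT.
have inB x : x \in T -> p x = b -> (x == s) || (x == t).
  by move=> xT xb; have /setP/(_ x) := EB; rewrite !inE xT xb eqxx.
have trb x : x \in T -> p x = b -> transversal (T :\ x).
  by move=> xT xb; rewrite (@transversalD1 T x t0).
have notO : s \notin O /\ t \notin O.
  split; apply/negP=> /O_single sO; move/eqP: st; apply.
    by apply/esym/sO; rewrite pt.
  by apply: sO; rewrite pt.
rewrite /koszul_diff (bigD1 s) //= (bigD1 t) /=; last by rewrite tT eq_sym.
rewrite big1 => [|x /andP[/andP[xT xs] xt]]; last first.
  rewrite /c ifN ?mulr0 //; apply/negP=> trx.
  have xb : p x != b.
    by apply/eqP=> xb; have := inB x xT xb; rewrite (negPf xs) (negPf xt).
  have := forall_inP trx b bB; rewrite (_ : [set _ in _ | _] = [set s; t]) ?cards2 ?st //.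
  rewrite -EB; apply/setP=> y; rewrite !inE.
  by case: (eqVneq y x) => // ->; rewrite (negPf xb) !andbF.
rewrite addr0 /c !trb // /g -!mpolyXD !trans_monD1 ?notO.1 ?notO.2 //.
rewrite (_ : rank_in rk T t = (rank_in rk T s).+1); last first.
  rewrite /rank_in (cardsD1 s) inE sT rk_lt ps pt eqxx lt_st orbT add1n; congr _.+1.
  apply: eq_card => x; rewrite !inE !rk_lt ps pt.
  case: (boolP (x \in T)) => xT; rewrite ?andbF //=.
  case: (eqVneq (p x) b) => [xb|_] /=; last first.
    rewrite !orbF; case: eqVneq => [->|] //=; by rewrite ps ltnn.
  rewrite xb ltnn /=; case/orP: (inB x xT xb) => /eqP->; rewrite ?eqxx ?ltnn ?andbF //.
  by rewrite ltnNge ltnW.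
by rewrite exprS mulN1r mulNr subrr.
Qed.

Lemma transversal_base : transversal B.
Proof.
apply/forall_inP=> b bB; apply/eqP; rewrite (_ : [set _ in _ | _] = [set b]) ?cards1 //.
apply/setP=> t; rewrite !inE; case: (eqVneq t b) => [->|].
  by move: bB; rewrite inE => ->.
by move=> tb; apply/negP=> /andP[/eqP tt]; rewrite tt (negPf tb).
Qed.

(** The coefficient of trans_mon B at the transversal B is 1 in the cocycle. In a
    coboundary it would come from the monomials trans_mon (B :\ b), which are not
    in I; for b in O, the monomial trans_mon B is not divisible by x_b^N because
    N exceeds u b. *)
Lemma regular_seq_size fs :
  (forall f, f \in fs -> graded_maximal_ideal (K:=K) (n:=n) f) ->
  regular_seq I fs -> (size fs <= #|B|)%N.
Proof.
move=> fs_max [fs_reg _]; rewrite leqNgt; apply/negP=> lt_size.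
have [idI upI IE] := monomial_idealE I_mon.
have fs_rad i : (i < size fs)%N -> exists k a, fs`_i ^+ k = \sum_t a t * g t.
  by move=> ilt; apply: graded_maximal_radical; apply: fs_max; apply: mem_nth.
have [||||e [Ie _ ce]] :=
    @koszul_acyclic _ _ _ g rk_inj _ _ idI fs_reg fs_rad #|B|.+1 0 c.
- by rewrite addn0.
- move=> T; rewrite /c; case: ifP => [/trans_in //|_]; by case: idI.
- move=> T BT; rewrite /c; case: ifP => // /card_transversal; lia.
- move=> T; rewrite trans_cocycle take0.
  by case: (@seq_mul_ideal _ [::] I idI).
have := ce B; rewrite take0 => /seq_mul_nil/eqP; rewrite subr_eq0 /c transversal_base.
move=> /eqP/(congr1 (mcoeff (trans_mon B))); rewrite mcoeffX eqxx raddf_sum big1 => [|t tB].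
  by move/eqP; rewrite oner_eq0.
rewrite /=; have -> k (f : S) : ((-1) ^+ k * f)@_(trans_mon B) = (-1) ^+ k * f@_(trans_mon B).
  by rewrite -signr_odd -[in RHS]signr_odd !mulr_sign; case: odd; rewrite ?mcoeffN.
case: (boolP (t \in O)) => tO.
  rewrite mcoeffXM_eq0 ?mulr0 //; apply/negP=> /mnm_lepP/(_ t).
  by rewrite mulmnE mnm1E eqxx mnmE !inE tO; have := uO tO; lia.
rewrite -(trans_monD1 tB tO) mcoeffXM_lem memN_msupp_eq0 ?mulr0 //.
by apply/negP=> /((IE _).1 (Ie _)); apply: base_notin.
Qed.

End DepthBound.

(** * Dickson's lemma *)

Section Dickson.

Lemma nat_pred_min (A : nat -> Prop) : (exists k, A k) ->
  exists k, A k /\ forall j, A j -> (k <= j)%N.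
Proof.
move=> [k Ak]; have exA : exists k, `[< A k >] by exists k; apply/asboolP.
case: (ex_minnP exA) => m /asboolP Am mmin; exists m; split=> // j Aj.
by apply: mmin; apply/asboolP.
Qed.

Lemma nat_pred_max (A : nat -> Prop) b : (exists k, A k) -> (forall j, A j -> (j <= b)%N) ->
  exists k, A k /\ forall j, A j -> (j <= k)%N.
Proof.
move=> [k Ak] Ab; have exA : exists k, `[< A k >] by exists k; apply/asboolP.
have ubA j : `[< A j >] -> (j <= b)%N by move/asboolP/Ab.
case: (ex_maxnP exA ubA) => m /asboolP Am mmax; exists m; split=> // j Aj.
by apply: mmax; apply/asboolP.
Qed.

Lemma max_nat_ge (A : set nat) k b : A k -> (forall j, A j -> (j <= b)%N) ->
  (k <= max_nat A)%N.
Proof.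
move=> Ak Ab; have [m [Am mmax]] := @nat_pred_max A b (ex_intro _ k Ak) Ab.
rewrite /max_nat; case: xgetP => [x _ [Ax xmax]|/(_ m)]; first exact: xmax.
by case.
Qed.

Lemma nondecreasing_leq (f : nat -> nat) : (forall i, (f i <= f i.+1)%N) ->
  forall i j, (i <= j)%N -> (f i <= f j)%N.
Proof.
move=> fS i j /subnKC <-; elim: (j - i)%N => [|k IHk]; first by rewrite addn0.
by rewrite addnS; apply: leq_trans IHk (fS _).
Qed.

Lemma increasing_ge (f : nat -> nat) : (forall i, (f i < f i.+1)%N) ->
  forall i, (i <= f i)%N.
Proof. by move=> fS; elim=> // i IHi; apply: leq_ltn_trans (fS i). Qed.

Lemma nondecreasing_subsequence (f : nat -> nat) : exists phi : nat -> nat,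
  (forall i, (phi i < phi i.+1)%N) /\ (forall i j, (i <= j)%N -> (f (phi i) <= f (phi j))%N).
Proof.
have ex_min k : exists j, (k <= j)%N /\ forall l, (k <= l)%N -> (f j <= f l)%N.
  have [|_ [[j [kj ->]] jmin]] := @nat_pred_min (fun v => exists j, (k <= j)%N /\ v = f j).
    by exists (f k), k.
  by exists j; split=> // l kl; apply: jmin; exists l.
have [a aP] := choice ex_min.
pose phi := fix phi i := if i is j.+1 then a (phi j).+1 else a 0%N.
exists phi; split=> [i|]; first by case: (aP (phi i).+1).
apply: nondecreasing_leq => i.
have: exists k, phi i = a k by case: i => [|i]; [exists 0%N|exists (phi i).+1].
case=> k phik; have [ki mini] := aP k; rewrite phik; apply: mini.
by rewrite /= -/phi; have [] := aP (phi i).+1; rewrite phik; lia.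
Qed.

Variable n : nat.
Implicit Types (m : 'X_{1..n}).

Lemma monomial_subsequence (f : nat -> 'X_{1..n}) (l : seq 'I_n) : exists phi : nat -> nat,
  (forall i, (phi i < phi i.+1)%N) /\
  (forall t, t \in l -> forall i j, (i <= j)%N -> (f (phi i) t <= f (phi j) t)%N).
Proof.
elim: l => [|t l [phi [phiS phiP]]]; first by exists id.
have [psi [psiS psiP]] := nondecreasing_subsequence (fun i => f (phi i) t).
exists (phi \o psi); split=> [i|s] /=.
  by apply: leq_trans (phiS _) _; apply: nondecreasing_leq => // k; apply: ltnW.
rewrite inE => /orP[/eqP-> //|sl i j ij].
by apply: phiP => //; apply: nondecreasing_leq => // k; apply: ltnW.
Qed.

Definition mtrunc N m : 'X_{1..n} := [multinom minn (m t) N | t < n].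

Definition mmin m m' : 'X_{1..n} := [multinom minn (m t) (m' t) | t < n].

(** Otherwise there are counterexamples for every N, and along a subsequence they
    increase in each coordinate. The first of them is below the truncation of a
    later one, since the truncation bounds tend to infinity. *)
Lemma dickson_bound (U : 'X_{1..n} -> Prop) : upclosed U ->
  exists N, forall m, U m -> U (mtrunc N m).
Proof.
move=> upU; apply: contrapT => noN.
have bad N : exists m, U m /\ ~ U (mtrunc N m).
  apply: contrapT => nom; apply: noN; exists N => m Um.
  by apply: contrapT => Utr; apply: nom; exists m.
have [f fP] := choice bad.
have [phi [phiS phiP]] := monomial_subsequence f (enum 'I_n).
pose N := \max_t f (phi 0%N) t.
have [_ []] := fP (phi N); apply: upU (fP (phi 0%N)).1.
apply/mnm_lepP=> t; rewrite mnmE leq_min phiP ?mem_enum //=.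
by apply: leq_trans (increasing_ge phiS N); apply: (leq_bigmax t).
Qed.

End Dickson.

(** * Stanley decompositions from orthants *)

Section StanleyCones.
Variables (K : fieldType) (n : nat).
Local Notation S := {mpoly K[n]}.
Implicit Types (I : set S) (m b : 'X_{1..n}) (Z : {set 'I_n}).

Definition cone b Z m := (b <= m)%MM /\ forall t, t \notin Z -> m t = b t.

Lemma zK_spanP b Z (h : S) :
  zK_span 'X_[b] Z h <-> forall m, m \in msupp h -> cone b Z m.
Proof.
split=> [[f fZ <-] m|hZ].
  rewrite mulrC (perm_mem (msuppMX _ _)) => /mapP[m' m'f ->]; split.
    exact: lem_addr.
  move=> t tZ; rewrite mnmDE; case: (eqVneq (m' t) 0%N) => [->|]; first by rewrite addn0.
  by move/(fZ _ m'f); rewrite (negPf tZ).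
exists (\sum_(m <- msupp h) h@_m *: 'X_[m - b]).
  move=> m' /msupp_sum_le/flattenP[l /mapP[m]]; rewrite filter_predT => mh ->.
  move/msuppZ_le; rewrite msuppX inE => /eqP-> t; rewrite mnmBE.
  by apply: contraR => /(hZ _ mh).2 ->; rewrite subnn.
rewrite [RHS]mpolyE mulr_sumr; apply: eq_big_seq => m /hZ[bm _].
by rewrite -scalerAr -mpolyXD addmC submK.
Qed.

Lemma sdepth_ge I r (z : 'I_r -> S) (Z : 'I_r -> {set 'I_n}) d :
  stanley_decomposition I z Z -> (d <= n)%N -> (forall i, d <= #|Z i|)%N ->
  (d <= sdepth I)%N.
Proof.
move=> decI dn dZ; apply: (@leq_trans (sdepth_decomp Z)).
  by apply: (big_ind (fun k => d <= k)%N) => // x y dx dy; rewrite leq_min dx.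
apply: (@max_nat_ge _ _ n); first by exists r, z, Z.
move=> _ [r' [z' [Z' [_ ->]]]]; apply: (big_ind (fun k => k <= n)%N) => // [x y xn _|i _].
  by rewrite geq_min xn.
by rewrite -[X in (_ <= X)%N]card_ord max_card.
Qed.

(** A decomposition is encoded by the map dir giving the set of directions of the
    orthant that contains a monomial of I. Two monomials are in the same orthant when
    they have the same directions and differ only in these. *)
Variables (I : set S) (dir : 'X_{1..n} -> {set 'I_n}) (N d : nat).
Local Notation U := (exps I).
Hypothesis I_mon : monomial_ideal I.
Hypothesis dirD : forall m t, U m -> t \in dir m -> dir (m + U_(t))%MM = dir m.
Hypothesis dir_min : forall m m', U m -> U m' -> dir m' = dir m ->
  (forall t, t \notin dir m -> m' t = m t) ->
  U (mmin m m') /\ dir (mmin m m') = dir m.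
Hypothesis trunc_in : forall m, U m -> U (mtrunc N m).
Hypothesis dir_trunc : forall m, U m -> dir (mtrunc N m) = dir m.
Hypothesis dir_bounded : forall m t, U m -> t \notin dir m -> (m t <= N)%N.
Hypothesis dir_card : forall m, U m -> (d <= #|dir m|)%N.
Hypothesis dn : (d <= n)%N.

Let cls m m' := [/\ U m', dir m' = dir m & forall t, t \notin dir m -> m' t = m t].

Lemma cls_trans m m' k : cls m m' -> cls m k <-> cls m' k.
Proof.
move=> [Um' dm' am']; split=> [] [Uk dk ak]; split=> //; rewrite ?dk ?dm' // => t.
- by move=> td; rewrite ak ?am'.
- by rewrite -dm' => td; rewrite ak // am' -?dm'.
Qed.

(** A class is closed under minima, so its element of least degree is its corner. *)
Lemma cls_min m : U m -> exists b, cls m b /\ forall m', cls m m' -> (b <= m')%MM.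
Proof.
move=> Um; have [|_ [[b [cb ->]] bmin]] :=
    @nat_pred_min (fun v => exists b, cls m b /\ v = mdeg b).
  by exists (mdeg m), m.
exists b; split=> // m' /[dup] cm' /(cls_trans _ cb) [Um' dm' am'].
have [Ub db ab] := cb.
have [Uk dk] := dir_min Ub Um' dm' am'; set k := mmin _ _ in Uk dk.
have kb : (k <= b)%MM by apply/mnm_lepP=> t; rewrite mnmE geq_minl.
have : cls m k.
  apply/(cls_trans _ cb); split=> // t td; rewrite mnmE am' // minnn //.
move=> ck; have := bmin _ (ex_intro _ k (conj ck erefl)).
rewrite -{1}(submK kb) mdegD => degk.
have /eqP : mdeg (b - k) = 0%N by lia.
rewrite mdeg_eq0 => /eqP bk0; have bk : b = k by rewrite -(submK kb) bk0 add0m.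
by rewrite bk; apply/mnm_lepP=> t; rewrite mnmE geq_minr.
Qed.

Lemma cls_up m m' k : cls m m' -> (m' <= k)%MM ->
  (forall t, t \notin dir m -> k t = m' t) -> cls m k.
Proof.
move=> cm' m'k; rewrite -(submK m'k) addmC.
move: (k - m')%MM => e {m'k k} ek.
elim: {e}(mdeg e) {-2}e (erefl (mdeg e)) ek => [|v IHv] e de ek.
  by move/eqP: de; rewrite mdeg_eq0 => /eqP ->; rewrite addm0.
have [t te] : exists t, e t != 0%N.
  apply: contrapT => e0; move: de; rewrite mdegE big1 // => t _.
  by apply/eqP/negPn/negP=> et; apply: e0; exists t.
have Ue : (U_(t) <= e)%MM by rewrite lep1mP.
have td : t \in dir m.
  by apply: contraNT te => /ek /eqP; rewrite mnmDE -{2}[m' t]addn0 eqn_add2l.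
have [||Uk dk ak] := IHv (e - U_(t))%MM.
- by have := congr1 (@mdeg n) (submK Ue); rewrite mdegD mdeg1 de; lia.
- move=> s sd; have := ek s sd; rewrite !mnmDE mnmBE; lia.
have <- : (m' + (e - U_(t)) + U_(t))%MM = (m' + e)%MM by rewrite -addmA submK.
split.
- by have [_ upI _] := monomial_idealE I_mon; apply: upI Uk; apply: lem_addr.
- by rewrite dirD // dk.
- move=> s sd; rewrite mnmDE ak // mnm1E; case: eqVneq => [st|_]; rewrite ?addn0 //.
  by rewrite -st td in sd.
Qed.

(** The classes are orthants, and there are finitely many of them because a corner
    is bounded by N in each coordinate. *)
Lemma sdepth_ge_dir : (d <= sdepth I)%N.
Proof.
have [idI upI IE] := monomial_idealE I_mon.
have [base baseP] : {base : 'X_{1..n} -> 'X_{1..n} & forall m, U m ->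
    cls m (base m) /\ forall m', cls m m' -> (base m <= m')%MM}.
  apply: (@choice _ _ (fun m b => U m -> cls m b /\ forall m', cls m m' -> (b <= m')%MM)).
  move=> m; have [Um|nU] := pselect (U m); last by exists m.
  by have [b bP] := cls_min Um; exists b.
have cls_refl m : U m -> cls m m by [].
have coneP m k : U m -> cone (base m) (dir m) k <-> cls m k.
  move=> Um; have [cb bmin] := baseP m Um; have [Ub db ab] := cb; split=> [[bk ak]|ck].
    exact: cls_up cb bk ak.
  by split=> [|t td]; [apply: bmin|case: ck => _ _ ->; rewrite ?ab].
have base_le m t : U m -> (base m t < N.+1)%N.
  move=> Um; have [_ bmin] := baseP m Um.
  have /bmin/mnm_lepP/(_ t) : cls m (mtrunc N m).
    split; [exact: trunc_in|exact: dir_trunc|move=> s sd].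
    by rewrite mnmE; apply/minn_idPl; apply: dir_bounded.
  by rewrite mnmE ltnS => /leq_trans; apply; apply: geq_minr.
pose lab m := ([ffun t => inord (base m t)] : {ffun 'I_n -> 'I_N.+1}, dir m).
pose L := [set l | `[< exists m, U m /\ lab m = l >]].
pose bs (l : {ffun 'I_n -> 'I_N.+1} * {set 'I_n}) : 'X_{1..n} := [multinom l.1 t : nat | t < n].
have bs_lab m : U m -> bs (lab m) = base m.
  by move=> Um; apply/mnmP=> t; rewrite mnmE ffunE inordK // base_le.
have lab_cls m k : U m -> cls m k -> lab k = lab m.
  move=> Um ck; have [Uk dk _] := ck; rewrite /lab dk; congr (_, _).
  suff -> : base k = base m by [].
  have [cb bmin] := baseP m Um; have [cb' bmin'] := baseP k Uk.
  apply/mnmP=> t; apply/eqP; rewrite eqn_leq; apply/andP; split.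
    by have /bmin'/mnm_lepP/(_ t) := (cls_trans (base m) ck).1 cb.
  by have /bmin/mnm_lepP/(_ t) := (cls_trans (base k) ck).2 cb'.
have LP l : l \in L -> exists m, [/\ U m, lab m = l, bs l = base m & l.2 = dir m].
  by rewrite inE => /asboolP[m [Um <-]]; exists m; rewrite bs_lab.
have cone_lab l k : l \in L -> cone (bs l) l.2 k -> U k /\ lab k = l.
  move=> /LP[m [Um lm -> ->]] /(coneP _ _ Um) ck; split; first by case: ck.
  by rewrite -lm; apply: lab_cls.
have lab_cone k : U k -> lab k \in L /\ cone (bs (lab k)) (lab k).2 k.
  move=> Uk; split; first by rewrite inE; apply/asboolP; exists k.
  by rewrite bs_lab //; apply/(coneP _ _ Uk).
pose lb (i : 'I_#|L|) := enum_val i.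
have lbL i : lb i \in L by apply: enum_valP.
have lb_inj : injective lb by apply: enum_val_inj.
apply: (@sdepth_ge I _ (fun i => 'X_[bs (lb i)]) (fun i => (lb i).2)) => //; last first.
  by move=> i; have [m [Um _ _ ->]] := LP _ (lbL i); apply: dir_card.
have span_in i (h : S) : zK_span 'X_[bs (lb i)] (lb i).2 h -> forall m, m \in msupp h ->
    U m /\ lab m = lb i.
  move=> hi m mh; have c := (zK_spanP _ _ h).1 hi m mh; exact: (cone_lab _ m (lbL i) c).
split.
- move=> i; have [m [Um lm bm dm]] := LP _ (lbL i); split.
  + by rewrite bm; have [[]] := baseP m Um.
  + by exists 1, (bs (lb i)); rewrite scale1r.
  + move=> f _ /eqP; rewrite mulf_eq0 => /orP[/eqP/(congr1 (mcoeff (bs (lb i))))|/eqP //].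
    by rewrite mcoeffX eqxx mcoeff0 => /eqP; rewrite oner_eq0.
- apply/seteqP; split=> [f If|_ [y yi ->]]; last first.
    apply: ideal_sum_closed => // i _; apply/IE => m mi.
    by have [] := span_in i (y i) (yi i isT) m mi.
  exists (fun i => \sum_(m <- msupp f | lab m == lb i) f@_m *: 'X_[m]).
    move=> i _; apply/zK_spanP => m /msupp_sum_le/flattenP[l /mapP[m']].
    rewrite mem_filter => /andP[/eqP lm' m'f] -> /msuppZ_le; rewrite msuppX inE => /eqP ->.
    by rewrite -lm'; apply: (lab_cone _ ((IE f).1 If _ m'f)).2.
  rewrite [LHS]mpolyE (exchange_big_dep xpredT) //=; apply: eq_big_seq => m mf.
  have [lL _] := lab_cone m ((IE f).1 If m mf).
  rewrite (bigD1 (enum_rank_in lL (lab m))) /=; last by rewrite /lb enum_rankK_in.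
  rewrite big1 ?addr0 // => i /andP[/eqP li]; apply: contraNeq => _.
  by apply/eqP/lb_inj; rewrite -li /lb enum_rankK_in.
- move=> h hi h0 i; apply/mpolyP=> m; rewrite mcoeff0.
  have [mi|/memN_msupp_eq0 //] := boolP (m \in msupp (h i)).
  have /(congr1 (mcoeff m)) := h0; rewrite raddf_sum mcoeff0 (bigD1 i) //= big1 ?addr0 //.
  move=> j ji; apply: memN_msupp_eq0; apply: contra ji => mj; apply/eqP/lb_inj.
  by have [_ <-] := span_in j _ (hi j) m mj; have [_ <-] := span_in i _ (hi i) m mi.
Qed.

End StanleyCones.

(** * Stanley depth from fibres that are orthants *)

Section Fibres.
Variables (K : fieldType) (n : nat).
Local Notation S := {mpoly K[n]}.
Implicit Types (m b : 'X_{1..n}) (s t : 'I_n).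
Variables (I : set S) (Y : {set 'I_n}) (extra : bool).
Local Notation U := (exps I).

(** The fibre of U through m in the directions of Y does not grow along t. *)
Definition stable m t := forall m' j, (forall s, s \notin Y -> m' s = m s) ->
  U (m' + U_(t) *+ j)%MM -> U m'.

Hypothesis I_mon : monomial_ideal I.
Hypothesis I_ex : exists m, U m.
Hypothesis min_closed : forall m m', U m -> U m' ->
  (forall t, t \notin Y -> m' t = m t) -> U (mmin m m').
Hypothesis stable_ex : extra -> forall m, U m -> exists t, t \notin Y /\ stable m t.

Section Bounded.
Variable N : nat.
Hypothesis trunc_in : forall m, U m -> U (mtrunc N m).

(** Directions outside Y: those in which m has passed the truncation bound, or, when
    there are none and an extra direction is wanted, the first stable one. *)
Let far m := [set t | (t \notin Y) && (N <= m t)%N].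
Let stb m := [set t | (t \notin Y) && `[< stable m t >]].
Let first m := [set t in stb m | [forall s in stb m, (t <= s)%N]].
Let side m := if far m != set0 then far m else if extra then first m else set0.
Let dir m := Y :|: side m.

Lemma side_disjoint m t : t \in side m -> t \notin Y.
Proof.
rewrite /side; case: ifP => _; first by rewrite inE => /andP[].
by case: ifP => _; rewrite !inE // => /andP[/andP[]].
Qed.

Lemma far_eq m m' : (forall t, t \notin Y -> m' t = m t) -> far m' = far m.
Proof. by move=> eqm; apply/setP=> t; rewrite !inE; case: (boolP (t \in Y)) => //= /eqm->. Qed.

Lemma stb_eq m m' : (forall t, t \notin Y -> m' t = m t) -> stb m' = stb m.
Proof.
move=> eqm; apply/setP=> t; rewrite !inE; congr (_ && _).
by apply/asboolP/asboolP => st m0 j m0E; apply: st => s sY; rewrite m0E ?eqm.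
Qed.

Lemma side_eq m m' : (forall t, t \notin Y -> m' t = m t) -> side m' = side m.
Proof. by move=> eqm; rewrite /side /first (far_eq eqm) (stb_eq eqm). Qed.

Lemma firstP m t : t \in first m -> first m = [set t].
Proof.
move=> /[dup] tm; rewrite inE => /andP[ts /forall_inP tle].
apply/setP=> s; rewrite in_set1; apply/idP/eqP => [|-> //].
rewrite inE => /andP[ss /forall_inP sle]; apply/val_inj/eqP.
by rewrite eqn_leq /= sle // tle.
Qed.

Lemma first_ex m : extra -> U m -> exists t, t \in first m.
Proof.
move=> ex Um; have [t [tY st]] := stable_ex ex Um.
have ts : t \in stb m by rewrite inE tY; apply/asboolP.
case: (@arg_minnP _ t (mem (stb m)) (@nat_of_ord n) ts) => s ss sle.
by exists s; rewrite in_set; apply/andP; split=> //; apply/forall_inP.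
Qed.

(** The set of stable directions decreases when m moves along one of them, while
    that direction stays stable; so the choice of the first one does not change. *)
Lemma stbS m t : t \in stb m -> stb (m + U_(t))%MM \subset stb m.
Proof.
have [_ upI _] := monomial_idealE I_mon.
rewrite inE => /andP[tY /asboolP st]; apply/subsetP=> s; rewrite !inE => /andP[-> /asboolP ss].
apply/asboolP=> m' j eqm Um'; apply: (st m' 1%N) => //; rewrite mulm1n.
apply: (ss _ j) => [x xY|]; first by rewrite !mnmDE eqm.
by apply: upI Um'; apply/mnm_lepP=> x; rewrite !mnmDE; lia.
Qed.

Lemma stb_self m t : t \in stb m -> t \in stb (m + U_(t))%MM.
Proof.
have [_ upI _] := monomial_idealE I_mon.
rewrite !inE => /andP[tY /asboolP st]; rewrite tY; apply/asboolP=> m' j eqm Um'.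
have Ut : (U_(t) <= m')%MM by rewrite lep1mP eqm // mnmDE mnm1E eqxx addn1.
apply: upI (lem_subr m' U_(t)) _; apply: (st _ j.+1) => [s sY|].
  by rewrite mnmBE eqm // mnmDE addnK.
by rewrite mulmS addmA submK.
Qed.

Lemma side_up m t : U m -> t \in side m -> side (m + U_(t))%MM = side m.
Proof.
move=> Um; rewrite /side; case: ifP => [f0|/negbFE/eqP f0].
  rewrite inE => /andP[tY Nt].
  suff -> : far (m + U_(t))%MM = far m by rewrite f0.
  apply/setP=> s; rewrite !inE mnmDE mnm1E; case: eqVneq => [<-|_]; rewrite ?addn0 //.
  by rewrite tY Nt (leq_trans Nt) ?leq_addr.
case: ifP => ex tf; last by rewrite inE in tf.
have tY : t \notin Y by move: tf; rewrite !inE => /andP[/andP[]].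
have farE s : s \notin Y -> (m s < N)%N.
  by move=> sY; have /setP/(_ s) := f0; rewrite !inE sY /= ltnNge => ->.
have [Nt|tN] := leqP N (m t).+1.
  have -> : far (m + U_(t))%MM = [set t].
    apply/setP=> s; rewrite !inE mnmDE mnm1E eq_sym; case: eqVneq => [->|st].
      by rewrite tY addn1.
    by rewrite addn0; case: (boolP (s \in Y)) => //= /farE; rewrite ltnNge => /negPf.
  by rewrite (firstP tf) ifT //; apply/set0Pn; exists t; rewrite inE.
have -> : far (m + U_(t))%MM = set0.
  apply/setP=> s; rewrite !inE mnmDE mnm1E; case: eqVneq => [<-|st].
    by rewrite tY addn1 leqNgt tN.
  by rewrite addn0; case: (boolP (s \in Y)) => //= /farE; rewrite ltnNge => /negPf.
rewrite eqxx /= (firstP tf); apply: firstP.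
move: tf; rewrite !in_set => /andP[ts /forall_inP tle].
have ts' : t \in stb m by rewrite in_set.
have := stb_self ts'; rewrite in_set => ->; apply/forall_inP=> s /(subsetP (stbS ts')).
exact: tle.
Qed.

Lemma mminC m m' : mmin m m' = mmin m' m.
Proof. by apply/mnmP=> t; rewrite !mnmE minnC. Qed.

(** Stability allows m' to be moved back along the chosen direction until it agrees
    with m outside Y, where closure under minima applies. *)
Lemma mmin_near m m' : U m -> U m' -> far m = set0 -> side m' = side m ->
  (forall t, t \notin dir m -> m' t = m t) -> (forall t, t \in side m -> (m t <= m' t)%N) ->
  U (mmin m m') /\ forall t, t \notin Y -> mmin m m' t = m t.
Proof.
move=> Um Um' f0 sE eqm lem; split; last first.
  move=> t tY; rewrite mnmE; apply/minn_idPl; case: (boolP (t \in side m)) => [/lem //|ts].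
  by rewrite eqm // inE negb_or tY.
have [s0|[t ts]] := set_0Vmem (side m).
  by apply: min_closed => // t tY; rewrite eqm // inE s0 inE orbF.
have [tst s1] : t \in stb m /\ side m = [set t].
  move: ts; rewrite /side f0 eqxx /=; case: ifP => _; last by rewrite inE.
  by move=> tf; split; [move: tf; rewrite inE => /andP[]|apply: firstP].
pose k : 'X_{1..n} := [multinom if s == t then m t else m' s | s < n].
have km s : s \notin Y -> k s = m s.
  move=> sY; rewrite mnmE; case: eqVneq => [->|st] //.
  by rewrite eqm // inE s1 inE negb_or sY.
have Uk : U k.
  move: tst; rewrite inE => /andP[tY /asboolP].
  move=> /(_ k (m' t - m t)%N); apply; first exact: km.
  rewrite (_ : (_ + _)%MM = m') //; apply/mnmP=> s.
  rewrite mnmDE mulmnE mnm1E mnmE; case: (eqVneq s t) => [->|st].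
    by rewrite mul1n subnKC ?lem ?s1 ?inE.
  by rewrite addn0.
have -> : mmin m m' = mmin m k.
  apply/mnmP=> s; rewrite !mnmE; case: eqVneq => [->|//].
  by rewrite minnn; apply/minn_idPl/lem.
exact: min_closed.
Qed.

(** Two monomials of one class that have both passed the bound are compared after
    truncation. Otherwise one of them lies before the other along the chosen stable
    direction, and the later one can be moved back to the same position. *)
Lemma side_min m m' : U m -> U m' -> side m' = side m ->
  (forall t, t \notin dir m -> m' t = m t) ->
  U (mmin m m') /\ side (mmin m m') = side m.
Proof.
have [_ upI _] := monomial_idealE I_mon.
move=> Um Um' sE eqm.
have near k k' : U k -> U k' -> far k = set0 -> side k' = side k ->
    (forall t, t \notin dir k -> k' t = k t) ->
    (forall t, t \in side k -> (k t <= k' t)%N) ->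
    U (mmin k k') /\ side (mmin k k') = side k.
  move=> Uk Uk' f0 sk eqk le.
  by have [Umin /side_eq] := mmin_near Uk Uk' f0 sk eqk le.
have eqm' t : t \notin dir m' -> m t = m' t by rewrite /dir sE => /eqm.
have far0 k t : far k = set0 -> t \notin Y -> (k t < N)%N.
  by move=> f0 tY; have /setP/(_ t) := f0; rewrite !inE tY /= ltnNge => ->.
have [f0|fn0] := eqVneq (far m) set0; have [f0'|fn0'] := eqVneq (far m') set0.
- have [le|] := boolP [forall t in side m, (m t <= m' t)%N].
    by apply: near => // t; apply: (forall_inP le).
  rewrite negb_forall_in => /exists_inP[t ts nle].
  have s1 : side m = [set t].
    move: ts; rewrite /side f0 eqxx /=; case: ifP => _; last by rewrite inE.
    exact: firstP.
  rewrite mminC -sE; apply: near => // s; rewrite sE s1 inE => /eqP ->.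
  by apply: ltnW; rewrite ltnNge.
- apply: near => // t; rewrite -sE => ts; apply: ltnW.
  apply: leq_trans (far0 _ _ f0 (side_disjoint ts)) _.
  by move: ts; rewrite /side fn0' inE => /andP[].
- rewrite mminC -sE; apply: near => // t; rewrite sE => ts; apply: ltnW.
  apply: leq_trans (far0 _ _ f0' (side_disjoint ts)) _.
  by move: ts; rewrite /side fn0 inE => /andP[].
have fE : far m' = far m by move: sE; rewrite /side fn0 fn0'.
have dirE : dir m = Y :|: far m by rewrite /dir /side fn0.
split.
  apply: upI (min_closed (trunc_in Um) (trunc_in Um') _).
    by apply/mnm_lepP=> t; rewrite !mnmE; lia.
  move=> t tY; rewrite !mnmE; case: (boolP (t \in far m)) => tf.
    have := tf; rewrite -fE !inE => /andP[_ N1]; move: tf; rewrite inE => /andP[_ N2].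
    by rewrite (minn_idPr N1) (minn_idPr N2).
  by rewrite eqm // dirE in_setU negb_or tY.
suff fm : far (mmin m m') = far m by rewrite /side fm fn0.
apply/setP=> t; rewrite -[in RHS](setIid (far m)) -{2}fE !inE mnmE leq_min.
by case: (t \in Y).
Qed.

Lemma sdepth_ge_bounded : (#|Y| + extra <= sdepth I)%N.
Proof.
have far_trunc m : far (mtrunc N m) = far m.
  by apply/setP=> t; rewrite !inE mnmE leq_min leqnn andbT.
have card m : U m -> (#|Y| + extra <= #|dir m|)%N.
  move=> Um; rewrite /dir cardsU disjoint_setI0 ?cards0 ?subn0 ?leq_add2l; last first.
    rewrite disjoint_sym disjoint_subset; apply/subsetP=> t /side_disjoint; exact.
  have [ex|] := boolP extra; last by rewrite leq0n.
  rewrite card_gt0 /side ex; case: ifP => // _.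
  by have [t tf] := first_ex ex Um; apply/set0Pn; exists t.
have [m0 Um0] := I_ex.
apply: (@sdepth_ge_dir _ _ I dir N) => //.
- move=> m t Um; rewrite in_setU => /orP[tY|ts]; rewrite /dir; last by rewrite side_up.
  congr (_ :|: _); apply: side_eq => s sY; rewrite mnmDE mnm1E.
  by case: eqVneq => [ts|_]; rewrite ?addn0 //; rewrite -ts tY in sY.
- move=> m m' Um Um' dE eqm; have [|Uk sk] := side_min Um Um' _ eqm; last by rewrite /dir sk.
  have sideE k : side k = dir k :\: Y.
    apply/setP=> t; rewrite in_setD in_setU; case: (boolP (t \in Y)) => //= tY.
    by apply/negbTE; apply: contraL tY => /side_disjoint.
  by rewrite !sideE dE.
- move=> m Um; rewrite /dir; congr (_ :|: _).
  have [f0|fn0] := eqVneq (far m) set0; last by rewrite /side far_trunc fn0.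
  apply: side_eq => t tY; rewrite mnmE; apply/minn_idPl; apply: ltnW.
  by have /setP/(_ t) := f0; rewrite !inE tY /= ltnNge => ->.
- move=> m t Um; rewrite in_setU negb_or => /andP[tY].
  apply: contraNT; rewrite -ltnNge => /ltnW Nt.
  have tf : t \in far m by rewrite inE tY.
  by rewrite /side ifT //; apply/set0Pn; exists t.
- by apply: leq_trans (card m0 Um0) _; rewrite -[X in (_ <= X)%N]card_ord max_card.
Qed.
End Bounded.

Theorem sdepth_ge_fibres : (#|Y| + extra <= sdepth I)%N.
Proof.
have [_ upI _] := monomial_idealE I_mon.
by have [N] := dickson_bound upI; apply: sdepth_ge_bounded.
Qed.

End Fibres.

(** * Bounds relative to a set W of variables *)

Section Criteria.
Variables (K : fieldType) (n : nat).
Local Notation S := {mpoly K[n]}.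
Implicit Types (m g F : 'X_{1..n}) (s t y : 'I_n) (W : {set 'I_n}).
Variable I : set S.
Hypothesis I_mon : monomial_ideal I.
Local Notation U := (exps I).

Lemma uniform_bound (A : finType) (P : pred A) (Q : A -> nat -> Prop) :
  (forall a i j, (i <= j)%N -> Q a i -> Q a j) ->
  (forall a, P a -> exists i, Q a i) -> exists N, forall a, P a -> Q a N.
Proof.
move=> Qmono Qex.
have [f fP] : {f : A -> nat & forall a, P a -> Q a (f a)}.
  apply: (@choice _ _ (fun a i => P a -> Q a i)) => a.
  by case: (boolP (P a)) => [/Qex[i Qi]|_]; [exists i|exists 0%N].
by exists (\max_a f a) => a Pa; apply: Qmono (fP a Pa); apply: (leq_bigmax a).
Qed.

(** The blocks are W1, W2 and the singletons outside their union; y1 and y2 complete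
    the transversal on which the cocycle is not a coboundary. *)
Lemma depth_le_two_blocks W1 W2 F y1 y2 :
  [disjoint W1 & W2] -> y1 \in W1 -> y2 \in W2 ->
  (forall s t, s \in W1 -> t \in W2 -> exists N, U (F + U_(s) *+ N + U_(t) *+ N)%MM) ->
  (forall N, ~ U (F + U_(y1) *+ N)%MM) -> (forall N, ~ U (F + U_(y2) *+ N)%MM) ->
  (depth I <= 2 + #|~: (W1 :|: W2)|)%N.
Proof.
have [_ upI _] := monomial_idealE I_mon.
move=> dis y1W y2W FU Fy1 Fy2.
have dis' t : t \in W1 -> t \in W2 -> False.
  by move=> t1 t2; move: dis; rewrite disjoint_subset => /subsetP/(_ t t1); rewrite inE t2.
have y12 : y1 != y2 by apply: contraTneq y1W => ->; apply/negP=> /dis'; apply.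
have [N1 N1P] : exists N, forall st : 'I_n * 'I_n, (st.1 \in W1) && (st.2 \in W2) ->
    U (F + U_(st.1) *+ N + U_(st.2) *+ N)%MM.
  apply: (@uniform_bound _ _ (fun st i => U (F + U_(st.1) *+ i + U_(st.2) *+ i)%MM)).
    move=> [s t] i j ij; apply: upI; apply/mnm_lepP=> x; rewrite !mnmDE !mulmnE; nia.
  by move=> [s t] /= /andP[sW tW]; apply: FU.
pose N := maxn N1 (\max_t F t).+1.
pose p t := if t \in W1 then y1 else if t \in W2 then y2 else t.
set O := ~: (W1 :|: W2).
have pO t : t \in O -> p t = t.
  by rewrite !inE negb_or /p => /andP[/negPf-> /negPf->].
have W2n1 t : t \in W2 -> (t \in W1) = false by move=> t2; apply/negP=> /dis'; apply.
have p2 t : t \in W2 -> p t = y2 by move=> t2; rewrite /p t2 W2n1.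
have p1 t : t \in W1 -> p t = y1 by rewrite /p => ->.
have p_idem t : p (p t) = p t.
  rewrite {2 3}/p; case: ifP => [_|t1]; first exact: p1.
  by case: ifP => [_|t2]; [exact: p2|rewrite /p t1 t2].
have O_single t s : t \in O -> p s = p t -> s = t.
  move=> tO; rewrite (pO t tO) /p; move: tO; rewrite !inE negb_or => /andP[t1 t2].
  by case: ifP => [_ yt|_]; [rewrite -yt y1W in t1|case: ifP => // _ yt; rewrite -yt y2W in t2].
have BE : [set t | p t == t] = y1 |: (y2 |: O).
  apply/setP=> t; rewrite !inE negb_or /p; case: (boolP (t \in W1)) => t1.
    rewrite eq_sym orbF; case: eqVneq => //= _; apply/esym/negbTE.
    by apply: contraTneq t1 => ->; rewrite W2n1.
  case: (boolP (t \in W2)) => t2; last by rewrite eqxx !orbT.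
  rewrite eq_sym orbF; case: (eqVneq t y1) => // ty; by rewrite ty y1W in t1.
have cardB : #|[set t | p t == t]| = (2 + #|O|)%N.
  by rewrite BE !cardsU1 !inE (negPf y12) y1W y2W orbT.
apply: depth_le => fs fs_max fs_reg; rewrite -cardB.
apply: (@regular_seq_size _ _ I p O F N) => //.
- move=> t _; rewrite /N; have := @leq_bigmax _ (fun t => F t) t; lia.
- move=> T /forall_inP trT.
  have pick b : b \in [set t | p t == t] -> exists2 x, x \in T & p x = b.
    move=> bB; have /cards1P[x /setP/(_ x)] := trT b bB.
    by rewrite !inE eqxx => /andP[? /eqP]; exists x.
  have [s sT ps] : exists2 s, s \in T & p s = y1 by apply: pick; rewrite BE !inE eqxx.
  have [t tT pt] : exists2 t, t \in T & p t = y2 by apply: pick; rewrite BE !inE eqxx orbT.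
  have sW : s \in W1.
    move: ps; rewrite /p; case: ifP => // s1; case: ifP => [_ E|_ E].
      by rewrite E eqxx in y12.
    by rewrite E y1W in s1.
  have tW : t \in W2.
    move: pt; rewrite /p; case: ifP => [_ E|_]; first by rewrite E eqxx in y12.
    by case: ifP => // t2 E; rewrite E y2W in t2.
  apply: upI (N1P (s, t) _); last by rewrite /= sW tW.
  have st : s != t by apply: contraTneq sW => ->; rewrite W2n1.
  apply/mnm_lepP=> x; rewrite !mnmDE !mulmnE !mnm1E mnmE !inE /= -addnA leq_add2l.
  have N1N : (N1 <= N)%N by rewrite leq_maxl.
  case: (eqVneq s x) => [<-|_].
    by rewrite eq_sym (negPf st) sT sW mul1n mul0n addn0 muln1.
  by case: (eqVneq t x) => [<-|_]; rewrite ?tT ?tW ?orbT ?mul1n ?muln1.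
- have trans_le y y' : [set t | p t == t] = y |: (y' |: O) ->
      (trans_mon O F N ([set t | p t == t] :\ y) <= F + U_(y') *+ N)%MM.
    move=> ->; apply/mnm_lepP=> x; rewrite mnmDE mulmnE mnm1E mnmE !inE leq_add2l.
    case: (eqVneq x y) => [_|_]; rewrite ?andbF ?muln0 //= eq_sym.
    by case: (eqVneq y' x) => [_|_]; [rewrite mulnC leq_mul2r leq_b1 orbT|rewrite /= andNb muln0].
  move=> b; rewrite BE !inE => /orP[/eqP->|/orP[/eqP->|-> //]] _; rewrite -BE => UT.
    by apply: (Fy2 N); apply: upI UT; apply: trans_le.
  by apply: (Fy1 N); apply: upI UT; apply: trans_le; rewrite BE setUCA.
Qed.

Lemma depth_le_one_block W F y : y \in W -> ~ U F ->
  (forall t, t \in W -> exists N, U (F + U_(t) *+ N)%MM) ->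
  (depth I <= 1 + #|~: W|)%N.
Proof.
have [_ upI _] := monomial_idealE I_mon.
move=> yW nF FU.
have [N1 N1P] : exists N, forall t, t \in W -> U (F + U_(t) *+ N)%MM.
  apply: uniform_bound FU => t i j ij; apply: upI.
  by apply/mnm_lepP=> x; rewrite !mnmDE !mulmnE; nia.
pose N := maxn N1 (\max_t F t).+1.
pose p t := if t \in W then y else t.
have p_idem t : p (p t) = p t by rewrite {2 3}/p; case: ifP => tW; rewrite /p ?yW ?tW.
have O_single t s : t \in ~: W -> p s = p t -> s = t.
  rewrite inE /p => tW; rewrite (negPf tW); case: ifP => // _ yt.
  by rewrite -yt yW in tW.
have BE : [set t | p t == t] = y |: ~: W.
  apply/setP=> t; rewrite !inE /p; case: ifP => tW; first by rewrite orbF eq_sym.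
  by rewrite eqxx orbT.
have cardB : #|[set t | p t == t]| = (1 + #|~: W|)%N by rewrite BE cardsU1 !inE yW.
apply: depth_le => fs fs_max fs_reg; rewrite -cardB.
apply: (@regular_seq_size _ _ I p (~: W) F N) => //.
- move=> t _; rewrite /N; have := @leq_bigmax _ (fun t => F t) t; lia.
- move=> T /forall_inP trT.
  have yB : y \in [set t | p t == t] by rewrite BE !inE eqxx.
  have /cards1P[s /setP/(_ s)] := trT y yB; rewrite !inE eqxx => /andP[sT /eqP ps].
  have sW : s \in W by move: ps; rewrite /p; case: ifP => // sW E; rewrite E yW in sW.
  apply: upI (N1P s sW); apply/mnm_lepP=> x.
  have N1N : (N1 <= N)%N by rewrite leq_maxl.
  rewrite !mnmDE !mulmnE !mnm1E mnmE !inE leq_add2l.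
  by case: (eqVneq s x) => [<-|_]; rewrite ?sT ?sW; lia.
- move=> b; rewrite BE !inE => /orP[/eqP->|-> //] _ UT; apply: nF; apply: upI UT.
  apply/mnm_lepP=> x; rewrite mnmE !inE.
  by case: (eqVneq x y) => [_|_]; rewrite ?andbF ?muln0 ?addn0 //= andNb muln0 addn0.
Qed.

(** Outside W the ideal looks principal: it has g as common factor, and raising an
    exponent above g has no effect. *)
Definition threshold g W := forall m, U m -> (forall t, t \notin W -> (g t <= m t)%N) /\
  U [multinom if t \in W then m t else g t | t < n].

Lemma threshold_min g W y m m' : threshold g W -> U m -> U m' ->
  (forall t, t \notin y |: ~: W -> m' t = m t) -> U (mmin m m').
Proof.
have [_ upI _] := monomial_idealE I_mon.
move=> thr; wlog le : m m' / (m y <= m' y)%N.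
  move=> wl Um Um' eqm; case: (leqP (m y) (m' y)) => [|/ltnW] le; first exact: wl.
  rewrite (_ : mmin m m' = mmin m' m); last by apply/mnmP=> t; rewrite !mnmE minnC.
  by apply: wl => // t tY; rewrite eqm.
move=> Um Um' eqm; have [gm Ug] := thr _ Um; have [gm' _] := thr _ Um'.
apply: upI Ug; apply/mnm_lepP=> t; rewrite !mnmE leq_min; case: ifP => tW.
  case: (eqVneq t y) => [->|ty]; first by rewrite leqnn.
  by rewrite eqm ?leqnn // !inE negb_or ty tW.
by rewrite gm ?gm' ?tW.
Qed.

Lemma sdepth_ge_threshold g W y : threshold g W -> y \in W -> (exists m, U m) ->
  (1 + #|~: W| <= sdepth I)%N.
Proof.
move=> thr yW exU.
have := @sdepth_ge_fibres _ _ I (y |: ~: W) false I_mon exU.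
rewrite cardsU1 !inE yW addn0; apply=> // m m'; exact: (threshold_min thr).
Qed.

(** Take Y to be y with the complement of W, and let c be the least exponent of y in
    the fibre of m. If c is 0, the fibre cannot grow along z. Otherwise the monomial
    just below the corner is outside I, and it stays outside along some t in W, which
    is not y; so the corner stays where it is along t. *)
Lemma sdepth_ge_threshold2 g W y z : threshold g W -> y \in W -> z \in W -> y != z ->
  (exists m, U m) ->
  (forall m, ~ U m -> exists t, t \in W /\ forall j, ~ U (m + U_(t) *+ j)%MM) ->
  (2 + #|~: W| <= sdepth I)%N.
Proof.
have [_ upI _] := monomial_idealE I_mon.
move=> thr yW zW yz exU ray.
have := @sdepth_ge_fibres _ _ I (y |: ~: W) true I_mon exU.
rewrite cardsU1 !inE yW addn1 add1n; apply=> [m m'|_ m Um]; first exact: (threshold_min thr).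
pose h v : 'X_{1..n} :=
  [multinom if t == y then v else if t \in W then m t else g t | t < n].
have lower m' t j : (forall s, s \notin y |: ~: W -> m' s = m s) ->
    U (m' + U_(t) *+ j)%MM -> t \in W -> (forall s, s \notin W -> (g s <= m' s)%N) /\
    U (h (m' y) + U_(t) *+ j)%MM.
  move=> eqm /thr[gm Ug] tW.
  have ts s : s \notin W -> (t == s) = false by move=> sW; apply: contraNF sW => /eqP <-.
  split=> [s sW|]; first by have := gm s sW; rewrite mnmDE mulmnE mnm1E ts // addn0.
  apply: upI Ug; apply/mnm_lepP=> s; rewrite !mnmE mulmnE !mnmE.
  case: (eqVneq s y) => [->|sy]; first by rewrite yW.
  by case: ifP => [sW|_]; [rewrite eqm // !inE negb_or sy sW|rewrite leq_addr].
have [|c [Uc cmin]] := @nat_pred_min (fun v => U (h v)).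
  exists (m y); have [_ Ug] := thr _ Um; apply: upI Ug; apply/mnm_lepP=> t; rewrite !mnmE.
  by case: (eqVneq t y) => [->|]; rewrite ?yW.
have above m' : (forall s, s \notin y |: ~: W -> m' s = m s) ->
    (forall s, s \notin W -> (g s <= m' s)%N) -> (c <= m' y)%N -> U m'.
  move=> eqm gm cy; apply: upI Uc; apply/mnm_lepP=> s; rewrite mnmE.
  case: (eqVneq s y) => [->//|sy]; case: ifP => sW; last by rewrite gm ?sW.
  by rewrite eqm // !inE negb_or sy sW.
case: (posnP c) => [c0|c_gt0].
  exists z; rewrite !inE negb_or eq_sym yz zW; split=> // m' j eqm /(lower _ _ _ eqm)[//|gm _].
  by apply: above => //; rewrite c0.
have nU : ~ U (h c.-1) by move=> /cmin; lia.
have [t [tW tray]] := ray _ nU.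
have ty : t != y.
  apply/eqP=> ty; apply: (tray 1%N); apply: upI Uc; apply/mnm_lepP=> s.
  rewrite mnmDE mulmnE mnm1E !mnmE ty eq_sym; case: eqVneq => // _; lia.
exists t; rewrite !inE negb_or ty tW; split=> // m' j eqm /(lower _ _ _ eqm)[//|gm Ul].
apply: above => //; rewrite leqNgt; apply/negP=> lt_c; apply: (tray j); apply: upI Ul.
apply/mnm_lepP=> s; rewrite !mnmDE leq_add2r !mnmE; case: ifP => // _; lia.
Qed.

Lemma depth_le_sdepth_one_block g W F y : threshold g W -> (exists m, U m) -> y \in W ->
  ~ U F -> (forall t, t \in W -> exists N, U (F + U_(t) *+ N)%MM) ->
  (depth I <= sdepth I)%N.
Proof.
move=> thr exU yW nF FU; apply: leq_trans (sdepth_ge_threshold thr yW exU).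
exact: depth_le_one_block yW nF FU.
Qed.

(** The blocks for depth are y and the rest of W. If H multiplied by powers of a
    variable t of the second block never enters I, then t and y give the transversal.
    If every such product enters I, then H is a socle element for W without y, and y
    becomes one of the singletons; the number of blocks is the same. *)
Lemma depth_le_sdepth_two_blocks g W y z H : threshold g W -> (exists m, U m) ->
  y \in W -> z \in W -> y != z ->
  (forall m, ~ U m -> exists t, t \in W /\ forall j, ~ U (m + U_(t) *+ j)%MM) ->
  (forall t, t \in W -> t != y -> exists N, U (H + U_(y) *+ N + U_(t) *+ N)%MM) ->
  (forall N, ~ U (H + U_(y) *+ N)%MM) -> (depth I <= sdepth I)%N.
Proof.
move=> thr exU yW zW yz ray HU nH.
apply: leq_trans (sdepth_ge_threshold2 thr yW zW yz exU ray).
have [[t [tW [ty nt]]]|no] := pselect (exists t, t \in W /\ t != y /\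
    forall N, ~ U (H + U_(t) *+ N)%MM).
  have WE : W = [set y] :|: (W :\ y) by rewrite setD1K.
  rewrite {1}WE; apply: (@depth_le_two_blocks [set y] (W :\ y) H y t) => //.
  - by rewrite disjoints1 !inE eqxx.
  - by rewrite inE.
  - by rewrite !inE ty.
  - by move=> x x'; rewrite !inE => /eqP -> /andP[x'y x'W]; apply: HU.
have -> : (2 + #|~: W| = 1 + #|~: (W :\ y)|)%N.
  by rewrite setCD setUC cardsU1 !inE yW.
have zWy : z \in W :\ y by rewrite !inE eq_sym yz.
apply: (depth_le_one_block zWy (F := H)) => [UH|t].
  by apply: (nH 0%N); rewrite mulm0n addm0.
rewrite !inE => /andP[ty tW]; apply: contrapT => nt; apply: no; exists t.
by do 2!split=> //; move=> N Ut; apply: nt; exists N.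
Qed.

End Criteria.

(** * Associated primes of a monomial ideal *)

Section AssociatedPrimes.
Variables (K : fieldType) (n : nat).
Local Notation S := {mpoly K[n]}.
Implicit Types (m : 'X_{1..n}) (s t : 'I_n) (A : {set 'I_n}) (f : S).

Lemma exps_nonempty (I : set S) : monomial_ideal I -> I <> [set 0]%classic ->
  exists m, exps I m.
Proof.
move=> /monomial_idealE[idI _ IE] In0; apply: contrapT => no; apply: In0.
apply/seteqP; split=> [f If|_ ->] /=; last by case: idI.
apply/eqP; apply: contrapT => /negP f0; apply: no; exists (mlead f).
by apply: (IE f).1 If _ _; apply: mlead_supp.
Qed.

Lemma strip (U : 'X_{1..n} -> Prop) f : exists f', [/\ supported_in U (f - f'),
  {subset msupp f' <= msupp f} & forall m, m \in msupp f' -> ~ U m].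
Proof.
pose f' := \sum_(m <- msupp f | ~~ `[< U m >]) f@_m *: 'X_[m].
have suppE (Q : pred 'X_{1..n}) m :
    m \in msupp (\sum_(m <- msupp f | Q m) f@_m *: 'X_[m] : S) -> Q m /\ m \in msupp f.
  move=> /msupp_sum_le/flattenP[l /mapP[m']]; rewrite mem_filter => /andP[Qm' mf] ->.
  by move/msuppZ_le; rewrite msuppX inE => /eqP ->.
exists f'; split=> [m|m /suppE[] //|m /suppE[/asboolPn] //].
rewrite {1}[f]mpolyE (bigID (fun m => `[< U m >])) /= addrK.
by case/suppE=> /asboolP.
Qed.

Definition var_ideal A : set S := supported_in (fun m => exists t, t \in A /\ m t != 0%N).

Lemma var_upclosed A : upclosed (fun m => exists t, t \in A /\ m t != 0%N).
Proof. by move=> m m' /mnm_lepP mm' [t [tA mt]]; exists t; split=> //; have := mm' t; lia. Qed.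

Lemma var_idealX A t : var_ideal A 'X_t <-> t \in A.
Proof.
split=> [/(_ U_(t)%MM)|tA m]; rewrite msuppX inE ?eqxx.
  by case=> // s [sA]; rewrite mnm1E; case: (eqVneq t s) => // ->.
by move/eqP->; exists t; rewrite mnm1E eqxx.
Qed.

Lemma var_ideal_prime A : prime_ideal (var_ideal A).
Proof.
have upA := @var_upclosed A; have idA := supported_in_ideal K upA; split=> // [|x y Axy].
  move/(_ 0%MM); rewrite msupp1 inE eqxx => /(_ isT)[t [_]].
  by rewrite mnm0E.
apply: contrapT => nxy.
have stripped z : ~ var_ideal A z -> exists z', [/\ var_ideal A (z - z'), z' != 0 &
    forall m, m \in msupp z' -> forall t, t \in A -> m t = 0%N].
  move=> nz; have [z' [zz' _ z'A]] := strip (fun m => exists t, t \in A /\ m t != 0%N) z.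
  exists z'; split=> // [|m mz' t tA].
    by apply/eqP=> z'0; apply: nz; move: zz'; rewrite z'0 subr0.
  by apply/eqP; apply: contrapT => /negP mt; apply: z'A mz' _; exists t.
have [|x' [xx' x'0 x'A]] := stripped x; first by move=> Ax; apply: nxy; left.
have [|y' [yy' y'0 y'A]] := stripped y; first by move=> Ay; apply: nxy; right.
have : var_ideal A (x' * y').
  rewrite (_ : x' * y' = x * y - (y * (x - x') + x' * (y - y'))); last by ring.
  apply: (ideal_sub idA) => //; case: (idA) => _ AD AM.
  by apply: AD; apply: AM.
move/(_ (mlead (x' * y'))); rewrite mlead_supp ?mulf_neq0 // mleadM // => /(_ isT)[t [tA]].
by rewrite mnmDE x'A ?mlead_supp // y'A ?mlead_supp.
Qed.

(** Stated for a pair Q, Q' to cover a prime ideal (Q' = Q) as well as a primary ideal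
    (Q' its radical). *)
Lemma monomial_factor (Q Q' : set S) m : ~ Q 1 ->
  (forall x y, Q (x * y) -> Q x \/ Q' y) -> Q 'X_[m] -> exists t, m t != 0%N /\ Q' 'X_t.
Proof.
move=> Q1 QQ'; elim: {m}(mdeg m) {-2}m (erefl (mdeg m)) => [|d IHd] m dm.
  by move/eqP: dm; rewrite mdeg_eq0 => /eqP ->; rewrite mpolyX0.
have [t mt] : exists t, m t != 0%N.
  apply: contrapT => m0; move: dm; rewrite mdegE big1 // => t _.
  by apply/eqP/negPn/negP=> mt; apply: m0; exists t.
have Um : (U_(t) <= m)%MM by rewrite lep1mP.
rewrite -(submK Um) mpolyXD => /QQ'[|Q't]; last by exists t; rewrite submK.
case/IHd; last first.
  by move=> s [ms Q's]; exists s; rewrite submK //; split=> //; move: ms; rewrite mnmBE; lia.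
by have := congr1 (@mdeg n) (submK Um); rewrite mdegD mdeg1; lia.
Qed.

Variable I : set S.
Hypothesis I_mon : monomial_ideal I.
Local Notation U := (exps I).

Lemma trunc_bound_ex : exists N, (0 < N)%N /\ forall m, U m -> U (mtrunc N m).
Proof.
have [_ upI _] := monomial_idealE I_mon.
have [N NP] := dickson_bound upI; exists N.+1; split=> // m /NP; apply: upI.
by apply/mnm_lepP=> t; rewrite !mnmE; lia.
Qed.

(** Let P = (I : f) be prime. Multiplying f by high powers of the variables outside P
    and dropping its monomials in I keeps it nonzero modulo I. Suppose that h' is in P
    and involves only variables outside P: the leading exponent of h' f is then that of
    f, up to coordinates that exceed the truncation bound already, so the leading
    monomial of f would be in I. *)
Lemma Ass_var_ideal P : Ass I P -> exists A, P = var_ideal A.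
Proof.
have [idI upI IE] := monomial_idealE I_mon; case: (idI) => I0 ID IM.
have [N [_ NP]] := trunc_bound_ex.
move=> [Pprime [f PE]]; have [idP P1 PM] := Pprime.
pose A := [set t | `[< P 'X_t >]]; exists A.
have AP : (var_ideal A `<=` P)%classic.
  move=> h hA; apply: ideal_of_exps => // m /hA[t [tA mt]].
  have Um : (U_(t) <= m)%MM by rewrite lep1mP.
  rewrite /exps -(submK Um) mpolyXD; case: (idP) => _ _; apply.
  by move: tA; rewrite inE => /asboolP.
apply/seteqP; split=> // h Ph.
have [h' [hh' _ h'A]] := strip (fun m => exists t, t \in A /\ m t != 0%N) h.
suff h'0 : h' = 0 by move: hh'; rewrite h'0 subr0.
apply/eqP; apply: contrapT => /negP h'0.
have Ph' : P h' by rewrite -(subKr h h'); apply: (ideal_sub idP) => //; apply: AP.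
pose w : 'X_{1..n} := [multinom if t \in A then 0%N else N | t < n].
have nPw : ~ P 'X_[w].
  move/(monomial_factor P1 PM) => [t]; rewrite mnmE; case: ifP => tA [] // _ Pt.
  by suff: t \in A by [rewrite tA]; rewrite inE; apply/asboolP.
have [k [wk kw kU]] := strip U ('X_[w] * f).
have k0 : k != 0.
  apply/eqP=> k0; apply: nPw; rewrite PE /=; apply/IE; by move: wk; rewrite k0 subr0.
have : I (h' * k).
  rewrite (_ : h' * k = 'X_[w] * (h' * f) - h' * ('X_[w] * f - k)); last by ring.
  by apply: (ideal_sub idI) => //; apply: (IM); [move: Ph'; rewrite PE|apply/IE].
move/(IE _).1/(_ (mlead (h' * k))); rewrite mlead_supp ?mulf_neq0 // mleadM // => /(_ isT).
move/NP => Utr; apply: (kU (mlead k)); first exact: mlead_supp.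
apply: upI Utr; apply/mnm_lepP=> t; rewrite mnmE mnmDE geq_min.
case: (boolP (t \in A)) => tA.
  have -> : mlead h' t = 0%N; last by rewrite add0n leqnn.
  apply/eqP; apply: contrapT => /negP ht; apply: (h'A (mlead h')); first exact: mlead_supp.
  by exists t.
have := kw _ (mlead_supp k0); rewrite mulrC (perm_mem (msuppMX _ _)) => /mapP[m _ ->].
by rewrite mnmDE mnmE (negPf tA) leq_addr orbT.
Qed.

(** I is the intersection of the irreducible ideals generated by the x_t^(a t + 1), t in A, where a is maximal outside U in the
    cube of side N and A is the set of coordinates with a t < N. Maximality gives
    (I : x^a) = (x_t, t in A). *)
Lemma Ass_escape N m : (forall m, U m -> U (mtrunc N m)) -> ~ U m ->
  exists A, [/\ Ass I (var_ideal A), forall t, t \in A -> (m t < N)%N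
    & forall m', (forall t, t \in A -> (m' t <= m t)%N) -> ~ U m'].
Proof.
have [idI upI IE] := monomial_idealE I_mon; case: (idI) => I0 ID IM.
move=> NP nUm.
have [||_ [[a [ma aN nUa ->]] amax]] := @nat_pred_max (fun v => exists a,
    [/\ (mtrunc N m <= a)%MM, forall t, (a t <= N)%N, ~ U a & v = mdeg a]) (n * N)%N.
- exists (mdeg (mtrunc N m)), (mtrunc N m); split=> //; first exact: lepm_refl.
    by move=> t; rewrite mnmE geq_minr.
  by move=> Ut; apply: nUm; apply: upI Ut; apply/mnm_lepP=> t; rewrite mnmE geq_minl.
- move=> _ [a [_ aN _ ->]]; rewrite mdegE -[X in (X * _)%N]card_ord -sum_nat_const.
  exact: leq_sum.
pose A := [set t | (a t < N)%N]; exists A.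
have mA t : t \in A -> (m t < N)%N /\ (m t <= a t)%N.
  by rewrite inE; have /mnm_lepP/(_ t) := ma; rewrite mnmE; lia.
have below m' : (forall t, t \in A -> (m' t <= a t)%N) -> ~ U m'.
  move=> m'A /NP Ut; apply: nUa; apply: upI Ut; apply/mnm_lepP=> t; rewrite mnmE.
  have := m'A t; rewrite inE; have := aN t; lia.
split=> [|t /mA[] //|m' m'A]; last first.
  by apply: below => t tA; have [_] := mA t tA; apply: leq_trans; apply: m'A.
split; first exact: var_ideal_prime.
exists 'X_[a]; apply/seteqP; split=> [f fA|f /= If m' m'f].
  apply/IE => k; rewrite (perm_mem (msuppMX _ _)) => /mapP[m' /fA[t [tA m't]] ->].
  have Ut : U (a + U_(t))%MM.
    apply: contrapT => nUt.
    suff: (mdeg (a + U_(t))%MM <= mdeg a)%N by rewrite mdegD mdeg1 addn1 ltnn.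
    apply: amax; exists (a + U_(t))%MM; split=> // [|s].
      exact: lepm_trans ma (lem_addr _ _).
    rewrite mnmDE mnm1E; case: (eqVneq t s) => [<-|_]; last by rewrite addn0.
    by move: tA; rewrite inE; lia.
  apply: upI Ut; apply/mnm_lepP=> s; rewrite !mnmDE leq_add2l mnm1E.
  by case: eqVneq => // <-; rewrite lt0n.
apply: contrapT => no; apply: (below (m' + a)%MM) => [t tA|].
  rewrite mnmDE (_ : m' t = 0%N) //; apply/eqP; apply: contrapT => /negP m't.
  by apply: no; exists t.
apply: (IE _).1 If _ _; rewrite (perm_mem (msuppMX _ _)) addmC; exact: map_f.
Qed.

End AssociatedPrimes.

(** * Primes with a private variable *)

Section PrivateVariables.
Variables (K : fieldType) (n : nat).
Local Notation S := {mpoly K[n]}.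

Lemma ideal_sum_ideal (R : comNzRingType) s (D : pred 'I_s) (Q : 'I_s -> set R) :
  (forall j, is_ideal (Q j)) -> is_ideal (ideal_sum D Q).
Proof.
move=> idQ; split.
- by exists (fun=> 0); [move=> j _; case: (idQ j)|rewrite big1].
- move=> _ _ [x Qx ->] [y Qy ->]; exists (fun j => x j + y j); last by rewrite big_split.
  by move=> j Dj; case: (idQ j) => _ QD _; apply: QD; [apply: Qx|apply: Qy].
- move=> a _ [x Qx ->]; exists (fun j => a * x j); last by rewrite mulr_sumr.
  by move=> j Dj; case: (idQ j) => _ _ QM; apply: QM; apply: Qx.
Qed.

Lemma ideal_sum_mem (R : comNzRingType) s (D : pred 'I_s) (Q : 'I_s -> set R) i x :
  (forall j, is_ideal (Q j)) -> D i -> Q i x -> ideal_sum D Q x.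
Proof.
move=> idQ Di Qx; exists (fun j => if j == i then x else 0).
  by move=> j _; case: eqVneq => [->//|_]; case: (idQ j).
by rewrite (bigD1 i) //= eqxx big1 ?addr0 // => j /andP[_ /negPf->].
Qed.

Variables (I : set S) (s : nat) (P : 'I_s -> set S).
Hypothesis I_mon : monomial_ideal I.
Hypothesis I_neq0 : I <> [set 0]%classic.
Hypothesis AssE : Ass I = range P.
Local Notation U := (exps I).

(** Each P_i has a variable y_i that is in no other P_j. The y_i with the variables O
    outside all the P_j form the set Y. Fibres along Y are closed under minima: if the
    minimum of m and m' is outside I, then some P_i is such that everything below it on
    the variables of P_i is outside I; but Y meets these variables only in y_i, so one
    of m and m' coincides with the minimum on them. *)
Theorem depth_le_sdepth_private :
  (forall i : 'I_s, ~ (P i `<=` ideal_sum (fun j => j != i) P)%classic) ->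
  (depth I <= sdepth I)%N.
Proof.
have [idI upI IE] := monomial_idealE I_mon => private.
have AssP i : Ass I (P i) by rewrite AssE; exists i.
have [A PE] := choice (fun i => Ass_var_ideal I_mon (AssP i)).
have idealP j : is_ideal (P j) by case: (AssP j) => [[]].
have exU := exps_nonempty I_mon I_neq0.
have [N [N0 NP]] := trunc_bound_ex I_mon.
have escape m : ~ U m -> exists i, (forall t, t \in A i -> (m t < N)%N) /\
    forall m' : 'X_{1..n}, (forall t, t \in A i -> (m' t <= m t)%N) -> ~ U m'.
  move=> /(Ass_escape I_mon NP) [A0 []]; rewrite AssE => -[i _ PA0] ltN nU.
  exists i; have AE t : (t \in A i) = (t \in A0).
    have E : var_ideal (A i) = var_ideal A0 :> set S by rewrite -PE.
    by apply/idP/idP => /(var_idealX K); [rewrite E|rewrite -E] => /var_idealX.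
  by split=> [t|m' m'A]; rewrite ?AE; [apply: ltN|apply: nU => t; rewrite -AE; apply: m'A].
have UA i m : U m -> exists t, t \in A i /\ m t != 0%N.
  move=> Um; have : P i 'X_[m].
    by have [_ [f ->]] := AssP i; rewrite /= mulrC; case: idI => _ _; apply.
  by rewrite PE => /(_ m); rewrite msuppX inE eqxx; apply.
have ex_private i : exists t, t \in A i /\ forall j, t \in A j -> j = i.
  apply: contrapT => no; apply: (private i) => f; rewrite PE => fA.
  apply: ideal_of_exps; first exact: ideal_sum_ideal.
  move=> m /fA[t [tA mt]].
  have [j [tj ji]] : exists j, t \in A j /\ j != i.
    apply: contrapT => noj; apply: no; exists t; split=> // j tj.
    by apply/eqP; apply: contrapT => /negP ji; apply: noj; exists j.
  apply: (@ideal_sum_mem _ _ _ _ j) => //.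
  by rewrite PE => k; rewrite msuppX inE => /eqP ->; exists t.
have [y yP] := choice ex_private.
have yA i : y i \in A i by case: (yP i).
have y_inj i j : y i \in A j -> j = i by apply: (yP i).2.
pose O := [set t | [forall i, t \notin A i]].
have OA t i : t \in O -> t \notin A i by rewrite inE => /forallP.
(* Each variable of some P_i goes to the block of one such y_i; the blocks then satisfy
   the condition on transversals, which meet every P_i. *)
pose p t := if [pick i | t \in A i] is Some i then y i else t.
have pO t : t \in O -> p t = t.
  by move=> tO; rewrite /p; case: pickP => // i; rewrite (negPf (OA t i tO)).
have py i : p (y i) = y i.
  rewrite /p; case: pickP => [j /y_inj -> //|/(_ i)]; by rewrite yA.
have pV t : (t \in O) || [exists i, (t \in A i) && (p t == y i)].
  case: (boolP (t \in O)) => //=; rewrite inE negb_forall => /existsP[i /negPn ti].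
  rewrite /p; case: pickP => [j tj|/(_ i)]; last by rewrite ti.
  by apply/existsP; exists j; rewrite tj eqxx.
have p_idem t : p (p t) = p t.
  by case/orP: (pV t) => [/pO pt|/existsP[i /andP[_ /eqP ->]]]; rewrite ?pt.
have pyA t i : p t = y i -> t \in A i /\ t \notin O.
  move=> pt; case/orP: (pV t) => [tO|/existsP[j /andP[tj /eqP ptj]]].
    by have := OA t i tO; rewrite -(pO t tO) pt yA.
  have -> : i = j by apply/esym/y_inj; rewrite -pt ptj yA.
  by split=> //; apply/negP=> /(OA t j); rewrite tj.
have O_single t t' : t \in O -> p t' = p t -> t' = t.
  move=> tO; rewrite (pO t tO); case/orP: (pV t') => [/pO -> //|].
  by case/existsP=> i /andP[_ /eqP->] yt; have := OA t i tO; rewrite -yt yA.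
pose Y := [set t | p t == t].
have YA t i : t \in Y -> t \in A i -> t = y i.
  rewrite inE => /eqP pt ti; case/orP: (pV t) => [/(OA t i)|]; first by rewrite ti.
  case/existsP=> j /andP[tj /eqP ptj]; rewrite -pt ptj; congr (y _).
  by apply/esym/y_inj; rewrite -ptj pt.
apply: (@leq_trans #|Y|).
  apply: depth_le => fs fs_max fs_reg.
  apply: (@regular_seq_size _ _ I p O 0%MM N) => //.
  - by move=> t _; rewrite mnm0E.
  - move=> T /forall_inP trT; apply: contrapT => /escape[i [ltN _]].
    have yY : y i \in [set t | p t == t] by rewrite inE py.
    have /cards1P[t /setP/(_ t)] := trT _ yY; rewrite !inE eqxx => /andP[tT /eqP pt].
    have [tA tO] := pyA t i pt; have := ltN t tA.
    by rewrite mnmE in_setD tT tO muln1 mnm0E ltnn.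
  - move=> b bY bO; have [i bi] : exists i, b = y i.
      case/orP: (pV b) => [bO'|/existsP[i /andP[_ /eqP pb]]]; first by rewrite bO' in bO.
      by exists i; rewrite -pb; move: bY; rewrite inE => /eqP.
    move=> /(UA i)[t [ti]]; rewrite mnmE in_setD in_setD1 mnm0E add0n.
    case: (eqVneq t b) => [_|tb]; first by rewrite andbF muln0.
    rewrite -/Y; case: (boolP (t \in Y)) => tY; last by rewrite !andbF muln0.
    by have := YA t i tY ti => tyi; rewrite tyi bi eqxx in tb.
rewrite -[#|Y|]addn0; apply: (@sdepth_ge_fibres _ _ I Y false) => // m m' Um Um' eqm.
apply: contrapT => /escape[i [_ nU]].
case: (leqP (m (y i)) (m' (y i))) => [le|/ltnW le].
  apply: (nU m) => // t ti; rewrite mnmE leq_min leqnn /=.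
  by case: (boolP (t \in Y)) => [/YA/(_ ti) -> //|/eqm ->].
apply: (nU m') => // t ti; rewrite mnmE leq_min leqnn andbT.
by case: (boolP (t \in Y)) => [/YA/(_ ti) -> //|/eqm ->].
Qed.

End PrivateVariables.

(** * Bigsize one *)

Section Bigsize.
Variables (K : fieldType) (n : nat).
Local Notation S := {mpoly K[n]}.
Implicit Types (m : 'X_{1..n}) (t : 'I_n).

Lemma primary_radical_mul (Q : set S) x y : primary_ideal Q -> radical Q (x * y) ->
  radical Q x \/ radical Q y.
Proof.
move=> [_ _ Qxy] [k]; rewrite exprMn => /Qxy[Qx|[l]]; first by left; exists k.
by rewrite -exprM => Qy; right; exists (k * l)%N.
Qed.

Lemma primary_one (Q : set S) : primary_ideal Q -> ~ radical Q 1.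
Proof. by case=> _ Q1 _ [k]; rewrite expr1n. Qed.

Lemma primary_pow_var (Q : set S) m t j : primary_ideal Q ->
  Q 'X_[m + U_(t) *+ j] -> Q 'X_[m] \/ radical Q 'X_t.
Proof.
move=> [_ _ Qxy]; rewrite mpolyXD => /Qxy[|[k]]; first by left.
by rewrite -mpolyXn -exprM => Qt; right; exists (j * k)%N.
Qed.

Lemma ideal_sum_monomial s (D : pred 'I_s) (Q : 'I_s -> set S) m :
  (forall i, monomial_ideal (Q i)) -> ideal_sum D Q 'X_[m] -> exists i, D i /\ Q i 'X_[m].
Proof.
move=> Qmon [y Qy Xm]; apply: contrapT => no.
have /(congr1 (mcoeff m)) := Xm; rewrite mcoeffX eqxx raddf_sum /= big1 => [/eqP|i Di].
  by rewrite oner_eq0.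
apply: memN_msupp_eq0; apply/negP=> my; apply: no; exists i; split=> //.
by have [_ _ QE] := monomial_idealE (Qmon i); apply: (QE _).1 (Qy i Di) _ my.
Qed.

Variable I : set S.
Hypothesis I_mon : monomial_ideal I.
Hypothesis I_neq0 : I <> [set 0]%classic.
Hypothesis I_proper : I <> [set: S]%classic.
Local Notation U := (exps I).

Section Decomposition.
Variables (s : nat) (Q : 'I_s -> set S).
Hypothesis Q_mon : forall i, monomial_ideal (Q i).
Hypothesis Q_dec : irredundant_primary_decomposition I Q.

Let A i := [set t | `[< radical (Q i) 'X_t >]].
Let W := [set t | [exists i, t \in A i]].

Let Q_primary i : primary_ideal (Q i). Proof. by case: Q_dec. Qed.
Let U_Q m : U m <-> forall i, Q i 'X_[m].
Proof.
case: Q_dec => _ _ IE _; rewrite /exps {1}IE.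
by split=> [Qm i|Qm i _]; [apply: Qm|apply: Qm].
Qed.
Let U_ex : exists m, U m. Proof. exact: exps_nonempty. Qed.

Let AP i t : reflect (radical (Q i) 'X_t) (t \in A i).
Proof. by rewrite inE; apply: asboolP. Qed.

Lemma component_ex : exists i : 'I_s, true.
Proof.
apply: contrapT => no; apply: I_proper; case: Q_dec => _ _ -> _.
by apply/seteqP; split=> // x _ i; case: no; exists i.
Qed.

Lemma support_nonempty : exists t, t \in W.
Proof.
have [i _] := component_ex; have [m Um] := U_ex; have [_ Q1 Qxy] := Q_primary i.
have [t [_ Qt]] := monomial_factor Q1 Qxy ((U_Q m).1 Um i).
by exists t; rewrite inE; apply/existsP; exists i; apply/AP.
Qed.

Lemma radical_monomial i m : radical (Q i) 'X_[m] -> exists t, m t != 0%N /\ t \in A i.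
Proof.
move=> rQ; have rQM x y := @primary_radical_mul _ x y (Q_primary i).
have [t [mt Qt]] := monomial_factor (primary_one (Q_primary i)) rQM rQ.
by exists t; split=> //; apply/AP.
Qed.

Lemma decomposition_threshold : threshold I 0%MM W.
Proof.
move=> m Um; split=> [t _|]; first by rewrite mnm0E.
set w : 'X_{1..n} := [multinom _ | _ < n].
have wm : (w <= m)%MM by apply/mnm_lepP=> t; rewrite mnmE mnm0E; case: ifP.
apply/U_Q => i; have := (U_Q m).1 Um i; rewrite -(submK wm) addmC mpolyXD.
case: (Q_primary i) => _ _ Qxy; case/Qxy => // /radical_monomial[t []].
rewrite mnmBE mnmE => mt ti; move: mt; rewrite ifT ?subnn //.
by rewrite inE; apply/existsP; exists i.
Qed.

Lemma A_W i t : t \in A i -> t \in W.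
Proof. by move=> ti; rewrite inE; apply/existsP; exists i. Qed.

(** A monomial that is in all components but Q i, which exists by irredundancy, is a
    socle element for W: all variables of W have a power in Q i. *)
Lemma depth_le_sdepth_full i : (forall t, t \in W -> t \in A i) -> (depth I <= sdepth I)%N.
Proof.
move=> WA; have [y yW] := support_nonempty.
apply: (@leq_trans (1 + #|~: W|)); last first.
  by apply: sdepth_ge_threshold decomposition_threshold yW U_ex.
have [_ _ IE /(_ i) irr] := Q_dec.
have [f [fQ nfQ]] : exists f, (forall j, j != i -> Q j f) /\ ~ Q i f.
  apply: contrapT => no; apply: irr; rewrite {1}IE; apply/seteqP.
  split=> [f fQ j _|f fQ j _]; first exact: fQ.
  have [->|ji] := eqVneq j i; last exact: fQ.
  by apply: contrapT => nfQ; apply: no; exists f.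
have [m [mf nQm]] : exists m, m \in msupp f /\ ~ Q i 'X_[m].
  have [idQ _ _] := monomial_idealE (Q_mon i).
  apply: contrapT => no; apply: nfQ; apply: ideal_of_exps idQ _ => m mf.
  by apply: contrapT => nQm; apply: no; exists m.
apply: (@depth_le_one_block _ _ I I_mon W m y yW); first by move/U_Q/(_ i).
move=> t /WA/AP[k]; rewrite mpolyXn => Qk; exists k; apply/U_Q => j; rewrite mpolyXD.
have [ij|ji] := eqVneq j i.
  by rewrite ij; have [[_ _ QM] _ _] := monomial_idealE (Q_mon i); apply: QM.
have [[_ _ QM] _ QE] := monomial_idealE (Q_mon j).
by rewrite mulrC; apply: QM; apply: (QE f).1 (fQ j ji) m mf.
Qed.

(** The sets missed by the components inside W are disjoint and not empty. The blocks
    are the set missed by the component i1 and its complement in W: two variables from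
    different blocks are never both missed by one component. *)
Lemma depth_le_sdepth_pairs (i1 i2 : 'I_s) : i1 != i2 ->
  (forall (i j : 'I_s) t, i != j -> t \in W -> t \in A i \/ t \in A j) ->
  (forall i, exists t, t \in W /\ t \notin A i) -> (depth I <= sdepth I)%N.
Proof.
move=> i12 pairs missing.
have [y1 [y1W y1A]] := missing i1; have [y2 [y2W y2A]] := missing i2.
have y1A2 : y1 \in A i2 by case: (pairs i1 i2 y1 i12 y1W) => //; rewrite (negPf y1A).
have y2A1 : y2 \in A i1 by case: (pairs i1 i2 y2 i12 y2W) => //; rewrite (negPf y2A).
have y12 : y1 != y2 by apply: contraNneq y1A => ->.
have notU t i m j : t \notin A i -> ~ Q i 'X_[m] -> ~ U (m + U_(t) *+ j)%MM.
  by move=> ti nQ /U_Q/(_ i)/(primary_pow_var (Q_primary i))[//|/AP]; apply/negP.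
apply: (@leq_trans (2 + #|~: W|)); last first.
  apply: (sdepth_ge_threshold2 I_mon decomposition_threshold y1W y2W y12 U_ex) => m nUm.
  have [i nQ] : exists i, ~ Q i 'X_[m].
    apply: contrapT => no; apply: nUm; apply/U_Q => i.
    by apply: contrapT => nQ; apply: no; exists i.
  have [t [tW ti]] := missing i; exists t; split=> // j; exact: notU nQ.
have -> : W = (W :\: A i1) :|: A i1.
  apply/setP=> t; rewrite in_setU in_setD; case: (boolP (t \in A i1)) => [/A_W ->//|].
  by rewrite orbF.
have notU0 t i N : t \notin A i -> ~ U (0 + U_(t) *+ N)%MM.
  by move=> ti; apply: notU ti _; rewrite mpolyX0; case: (Q_primary i).
apply: (@depth_le_two_blocks _ _ I I_mon _ _ 0%MM y1 y2).
- by rewrite disjoint_subset; apply/subsetP=> t; rewrite !inE => /andP[].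
- by rewrite in_setD y1A.
- exact: y2A1.
- move=> u t; rewrite in_setD => /andP[uA uW] tA.
  have [N NP] : exists N, forall i : 'I_s, true -> Q i 'X_[0 + U_(u) *+ N + U_(t) *+ N].
    apply: (@uniform_bound _ _ (fun i N => Q i 'X_[0 + U_(u) *+ N + U_(t) *+ N])).
      move=> i a b ab; have [_ upQ _] := monomial_idealE (Q_mon i); apply: upQ.
      by apply/mnm_lepP=> x; rewrite !mnmDE !leq_add // !mulmnE leq_mul2l ab orbT.
    move=> i _; have [idQ upQ _] := monomial_idealE (Q_mon i).
    have [/AP[k]|/AP[k]] : u \in A i \/ t \in A i.
      have [->|ii] := eqVneq i i1; first by right.
      by case: (pairs i i1 u ii uW) => [|ui]; [left|rewrite ui in uA].
    + rewrite mpolyXn => Qk; exists k; apply: upQ Qk; rewrite add0m.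
      exact: lem_addr.
    + rewrite mpolyXn => Qk; exists k; apply: upQ Qk; exact: lem_addl.
  by exists N; apply/U_Q => i; apply: NP.
- by move=> N; apply: notU0 y1A.
- by move=> N; apply: notU0 y2A.
Qed.

Lemma bigsize_a_mem : (1 <= bigsize_a Q <= s)%N /\
  forall T : {set 'I_s}, #|T| = bigsize_a Q ->
    radical (ideal_sum (mem T) Q) = radical (ideal_sum predT Q).
Proof.
have [i _] := component_ex.
set D := [set t | (1 <= t <= s)%N /\ forall T : {set 'I_s}, #|T| = t ->
    radical (ideal_sum (mem T) Q) = radical (ideal_sum predT Q)]%classic.
have [|a [Da amin]] := @nat_pred_min D.
  exists s; split=> [|T Ts]; first by rewrite leqnn (leq_ltn_trans (leq0n i)).
  have -> : T = setT by apply/eqP; rewrite eqEcard subsetT cardsT card_ord Ts leqnn.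
  congr (radical (ideal_sum _ Q)); apply/funext => j; exact: (in_setT j).
have : D (bigsize_a Q); last by [].
by rewrite /bigsize_a /min_nat -/D; case: xgetP => [x _ []|/(_ a)[]].
Qed.

Lemma radical_ideal_sum (T : {set 'I_s}) t :
  radical (ideal_sum (mem T) Q) = radical (ideal_sum predT Q) -> t \in W ->
  exists2 i, i \in T & t \in A i.
Proof.
move=> radE; rewrite inE => /existsP[i /AP[k Qk]].
have : radical (ideal_sum predT Q) 'X_t.
  by exists k; apply: (ideal_sum_mem (i := i)) => // j; case: (Q_primary j).
rewrite -radE => -[l]; rewrite mpolyXn => /(ideal_sum_monomial Q_mon)[j [jT Qj]].
by exists j => //; apply/AP; exists l; rewrite mpolyXn.
Qed.

Lemma depth_le_sdepth_bigsize_a : (bigsize_a Q <= 2)%N -> (depth I <= sdepth I)%N.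
Proof.
have [/andP[a_gt0 a_le] radE] := bigsize_a_mem => a2.
have [i0 _] := component_ex.
have [[i WA]|missing] := pselect (exists i, forall t, t \in W -> t \in A i).
  exact: depth_le_sdepth_full WA.
have missing' i : exists t, t \in W /\ t \notin A i.
  apply: contrapT => no; apply: missing; exists i => t tW.
  by apply/negPn/negP=> ti; apply: no; exists t.
have aE : bigsize_a Q = 2%N.
  apply/eqP; rewrite eqn_leq a2 ltnNge; apply/negP=> a1.
  have [t [tW]] := missing' i0; case/negP.
  have [|i] := @radical_ideal_sum [set i0] t _ tW; last by rewrite inE => /eqP ->.
  by apply: radE; rewrite cards1; lia.
have s2 : (1 < s)%N by rewrite -aE.
pose i1 := Ordinal (ltnW s2); pose i2 := Ordinal s2.
apply: (@depth_le_sdepth_pairs i1 i2) => // i j t ij tW.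
have [|k] := @radical_ideal_sum [set i; j] t _ tW.
  by apply: radE; rewrite cards2 ij aE.
by rewrite !inE => /orP[] /eqP ->; [left|right].
Qed.

End Decomposition.

(** The number a' is at least 1, so bigsize 1 bounds it by 2. *)
Theorem depth_le_sdepth_bigsize : bigsize I = 1%N -> (depth I <= sdepth I)%N.
Proof.
rewrite /bigsize; case: xgetP => // k -> [s [Q [Qmon Qdec ->]]] sizeE.
apply: (depth_le_sdepth_bigsize_a Qmon Qdec).
by move: sizeE; rewrite /bigsize_decomp; lia.
Qed.

End Bigsize.

(** * The lexicographic order *)

Section Lex.
Variable n : nat.
Implicit Types (a b c m w : 'X_{1..n}) (i j k s t : 'I_n).

Definition lex_gt a b := exists i, (forall j, (j < i)%N -> a j = b j) /\ (b i < a i)%N.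

Lemma lex_trichotomy a b : [\/ a = b, lex_gt a b | lex_gt b a].
Proof.
have [->|ab] := eqVneq a b; first by apply: Or31.
have /existsP[t0 abt0] : [exists t, a t != b t].
  rewrite -[[exists _, _]]negbK negb_exists; apply: contra ab => /forallP abE.
  by apply/eqP/mnmP=> t; have := abE t; rewrite negbK => /eqP.
case: (@arg_minnP _ t0 (fun t => a t != b t) (@nat_of_ord n) abt0) => i abi imin.
have agree j : (j < i)%N -> a j = b j.
  by move=> ji; apply/eqP; apply: contraTT ji; rewrite -leqNgt; apply: imin.
case: (ltngtP (a i) (b i)) => abi'; last by rewrite abi' eqxx in abi.
  by apply: Or33; exists i; split=> // j /agree.
by apply: Or32; exists i.
Qed.

Lemma lex_gt_asym a b : lex_gt a b -> lex_gt b a -> False.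
Proof.
move=> [i [iE ltb]] [j [jE lta]]; case: (ltngtP i j) => [/jE|/iE|/val_inj ij]; first lia.
  by lia.
by subst j; lia.
Qed.

Lemma lex_gt_trans b a c : lex_gt a b -> lex_gt b c -> lex_gt a c.
Proof.
move=> [i [iE lti]] [j [jE ltj]]; case: (ltngtP i j) => [ij|ji|/val_inj ij].
- exists i; split=> [x xi|]; last by rewrite -jE.
  by rewrite iE // jE // (ltn_trans xi).
- exists j; split=> [x xj|]; last by rewrite iE.
  by rewrite iE ?jE // (ltn_trans xj).
- subst j; exists i; split=> [x xi|]; first by rewrite iE // jE.
  exact: ltn_trans ltj lti.
Qed.

Lemma lex_ge_gt a b : ~ lex_ge a b -> lex_gt b a.
Proof.
by case: (lex_trichotomy a b) => // [->|ab] nab; case: nab; [left|right].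
Qed.

Lemma lex_gt_nge a b : lex_gt b a -> ~ lex_ge a b.
Proof. by move=> ba [ab|/lex_gt_asym]; [subst b; apply: (lex_gt_asym ba)|apply]. Qed.

Lemma lex_ge_trans b a c : lex_ge a b -> lex_ge b c -> lex_ge a c.
Proof.
move=> [->//|ab] [<-|bc]; first by right.
by right; apply: lex_gt_trans ab bc.
Qed.

Lemma lex_ge_gt_trans b a c : lex_ge a b -> lex_gt b c -> lex_gt a c.
Proof. by move=> [->//|ab]; apply: lex_gt_trans. Qed.

Lemma lex_ge_agree a b k : lex_ge a b -> (forall j, (j < k)%N -> (a j <= b j)%N) ->
  forall j, (j < k)%N -> b j = a j.
Proof.
move=> [->//|[i [iE lti]]] le j jk; apply/esym/iE; apply: leq_trans jk _.
by rewrite leqNgt; apply/negP=> /le; lia.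
Qed.

Lemma lex_ge_at a b k : lex_ge a b -> (forall j, (j < k)%N -> a j = b j) -> (b k <= a k)%N.
Proof.
move=> [->//|[i [iE lti]]] eqk; case: (ltngtP k i) => [/iE ->//|/eqk|/val_inj ->]; lia.
Qed.

Lemma lex_ge_add c a b : lex_ge a b -> lex_ge (a + c)%MM (b + c)%MM.
Proof.
case=> [->|[i [iE lti]]]; first by left.
by right; exists i; split=> [j /iE|]; rewrite !mnmDE ?ltn_add2r // => ->.
Qed.

Lemma lex_ge_var a s t : (s <= t)%N -> lex_ge (a + U_(s))%MM (a + U_(t))%MM.
Proof.
rewrite leq_eqVlt => /orP[/eqP/val_inj->|st]; first by left.
right; exists s; split=> [j js|]; rewrite !mnmDE !mnm1E.
  by rewrite -!val_eqE /= !gtn_eqF // (ltn_trans js).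
by rewrite eqxx -val_eqE /= gtn_eqF // addn0 addn1.
Qed.

(** With equal degrees, dominating in all coordinates but the last one is enough: the
    first difference cannot be at the last coordinate. *)
Lemma lex_ge_last a b k : (forall t, (t <= k)%N) -> mdeg a = mdeg b ->
  (forall t, t != k -> (b t <= a t)%N) -> lex_ge a b.
Proof.
move=> klast dab le; case: (lex_trichotomy a b) => [->|ab|[i [iE lti]]]; [by left|by right|].
have ik : i = k by apply/eqP; apply: contraTT lti => /le; rewrite -leqNgt.
subst i; suff ab : (mdeg a < mdeg b)%N by rewrite dab ltnn in ab.
rewrite !mdegE (bigD1 k) //= [X in (_ < X)%N](bigD1 k) //= -addSn leq_add //.
apply: leq_sum => t tk; rewrite iE // ltn_neqAle klast andbT.
by apply: contra tk => /eqP/val_inj ->.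
Qed.

Lemma lex_squeeze a w b i : lex_ge a w -> lex_ge w b -> (forall j, (j < i)%N -> a j = b j) ->
  forall j, (j < i)%N -> w j = a j.
Proof.
move=> [->//|[k [kE ltk]]] wb ab j ji; apply/esym/kE; apply: leq_trans ji _.
rewrite leqNgt; apply/negP=> ki; have := lex_ge_at wb (k := k).
rewrite -ab // => /(_ _); have : forall j0, (j0 < k)%N -> w j0 = b j0.
  by move=> x xk; rewrite -kE // ab // (ltn_trans xk).
by move=> H /(_ H); lia.
Qed.

Lemma monomial_between a m d : (a <= m)%MM -> (mdeg a <= d <= mdeg m)%N ->
  exists w, [/\ (a <= w)%MM, (w <= m)%MM & mdeg w = d].
Proof.
have [x] : exists x, (d - mdeg a)%N = x by exists (d - mdeg a)%N.
elim: x a => [|x IHx] a dk am /andP[ad dm].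
  by exists a; split=> //; [exact: lepm_refl|lia].
have [t tm] : exists t, (a t < m t)%N.
  apply: contrapT => no; suff : (mdeg m <= mdeg a)%N by lia.
  rewrite !mdegE; apply: leq_sum => t _; rewrite leqNgt; apply/negP=> tm.
  by apply: no; exists t.
have [|||w [aw wm dw]] := IHx (a + U_(t))%MM.
- by rewrite mdegD mdeg1; lia.
- apply/mnm_lepP=> s; rewrite mnmDE mnm1E; have := mnm_lepP am s.
  by case: (eqVneq t s) => [<-|_]; lia.
- by rewrite mdegD mdeg1; lia.
- by exists w; split=> //; apply: lepm_trans aw; apply: lem_addr.
Qed.

Section Tail.
Variable i : 'I_n.

Definition tail_deg m := (\sum_(t : 'I_n | (i < t)%N) m t)%N.

Lemma tail_degD a b : tail_deg (a + b)%MM = (tail_deg a + tail_deg b)%N.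
Proof. by rewrite -big_split; apply: eq_bigr => t _; rewrite mnmDE. Qed.

Lemma tail_degMn a e : tail_deg (a *+ e)%MM = (tail_deg a * e)%N.
Proof. by rewrite big_distrl; apply: eq_bigr => t _; rewrite mulmnE. Qed.

Lemma tail_deg_var t : tail_deg U_(t)%MM = (i < t)%N.
Proof.
rewrite /tail_deg; case: ltnP => it.
  rewrite (bigD1 t) //= mnm1E eqxx big1 // => s /andP[_ /negPf].
  by rewrite mnm1E eq_sym => ->.
rewrite big1 // => s si; rewrite mnm1E; case: eqVneq => // ts.
by move: it; rewrite ts leqNgt si.
Qed.

Lemma tail_deg_le a b : (forall t, (i < t)%N -> (a t <= b t)%N) -> (tail_deg a <= tail_deg b)%N.
Proof. by move=> ab; apply: leq_sum. Qed.

Lemma tail_deg_eq0 m t : tail_deg m = 0%N -> (i < t)%N -> m t = 0%N.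
Proof. by move=> /eqP; rewrite sum_nat_eq0 => /forall_inP m0 /m0/eqP. Qed.

Lemma tail_deg_set m (X : {set 'I_n}) : (forall t, t \in X -> (i < t)%N) ->
  (\sum_(t in X) m t <= tail_deg m)%N.
Proof.
move=> Xi; rewrite /tail_deg [X in (_ <= X)%N](bigID (mem X)) /=.
apply: leq_trans (leq_addr _ _); rewrite leq_eqVlt; apply/orP; left; apply/eqP.
by apply: eq_bigl => t; case: (boolP (t \in X)) => [/Xi ->|]; rewrite ?andbF.
Qed.

Lemma tail_deg_ge1 m s : (i < s)%N -> (m s <= tail_deg m)%N.
Proof.
move=> si; have := @tail_deg_set m [set s]; rewrite big_set1; apply.
by move=> x; rewrite inE => /eqP ->.
Qed.

Lemma tail_deg_ge2 m s t : (i < s)%N -> (i < t)%N -> s != t -> (m s + m t <= tail_deg m)%N.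
Proof.
move=> si ti st; have := @tail_deg_set m [set s; t].
rewrite big_setU1 ?inE //= big_set1; apply.
by move=> x; rewrite !inE => /orP[]/eqP ->.
Qed.

Lemma tail_deg_ge3 m s t k : (i < s)%N -> (i < t)%N -> (i < k)%N ->
  s != t -> s != k -> t != k -> (m s + m t + m k <= tail_deg m)%N.
Proof.
move=> si ti ki st sk tk; have := @tail_deg_set m [set s; t; k].
rewrite -setUA big_setU1 ?inE ?negb_or ?st //= big_setU1 ?inE //= big_set1 addnA; apply.
by move=> x; rewrite !inE => /or3P[]/eqP ->.
Qed.

Lemma mdeg_split m : mdeg m = (\sum_(t : 'I_n | (t < i)%N) m t + (m i + tail_deg m))%N.
Proof.
rewrite mdegE (bigID (fun t : 'I_n => (t < i)%N)) /=; congr (_ + _)%N.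
rewrite (bigD1 i) /= ?ltnn //; congr (_ + _)%N; apply: eq_bigl => t.
by rewrite -leqNgt andbC ltn_neqAle; congr (_ && _); rewrite eq_sym.
Qed.

Lemma mdeg_tail a b : (forall t, (t < i)%N -> a t = b t) ->
  mdeg a = mdeg b <-> (a i + tail_deg a = b i + tail_deg b)%N.
Proof.
move=> ab; rewrite !mdeg_split (eq_bigr b) => [|t /ab //].
by split=> [/addnI|->].
Qed.

End Tail.
End Lex.

(** * Lexsegment ideals *)

Section Lexsegment.
Variables (K : fieldType) (n : nat) (I : set {mpoly K[n]}) (d : nat) (u v : 'X_{1..n}).
Implicit Types (m w g : 'X_{1..n}) (j k l p s t : 'I_n) (W : {set 'I_n}).
Hypothesis d_gt0 : (0 < d)%N.
Hypothesis du : mdeg u = d.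
Hypothesis dv : mdeg v = d.
Hypothesis uv : lex_ge u v.
Hypothesis IE : I = monomial_gen (lexsegment d u v).
Local Notation U := (exps I).
Local Notation seg := (lexsegment d u v).

Lemma lexsegment_monomial : monomial_ideal I.
Proof. by exists (lexsegment d u v). Qed.
Local Notation I_mon := lexsegment_monomial.

Lemma lexsegment_exps m : U m <-> exists w, seg w /\ (w <= m)%MM.
Proof.
have [idI upI _] := monomial_idealE I_mon.
split=> [|[w [ws wm]]]; last first.
  by apply: upI wm _; rewrite /exps IE => J idJ GJ; apply: GJ; exists w.
rewrite /exps {1}IE => Im.
have : supported_in (fun m => exists w, seg w /\ (w <= m)%MM) ('X_[m] : {mpoly K[n]}).
  apply: Im => [|_ /= [w ws <-] m']; last first.
    by rewrite msuppX inE => /eqP ->; exists w; split=> //; apply: lepm_refl.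
  apply: supported_in_ideal => a b ab [w [ws wa]]; exists w; split=> //.
  exact: lepm_trans wa ab.
by apply; rewrite msuppX inE.
Qed.

Lemma lexsegment_ex : exists m, U m.
Proof.
by exists u; apply/lexsegment_exps; exists u; split; [split=> //; left|apply: lepm_refl].
Qed.

Lemma lexsegment_threshold g W : (forall w, seg w -> forall t, t \notin W -> w t = g t) ->
  threshold I g W.
Proof.
move=> wg m /lexsegment_exps[w [ws /mnm_lepP wm]]; split=> [t tW|].
  by rewrite -(wg w).
apply/lexsegment_exps; exists w; split=> //; apply/mnm_lepP=> t.
by rewrite mnmE; case: ifP => [_|/negbT tW]; rewrite ?wm // (wg w).
Qed.

Lemma lexsegment_deg m : U m -> (d <= mdeg m)%N.
Proof.
move=> /lexsegment_exps[w [[<- _ _] /mnm_lepP wm]].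
by rewrite !mdegE; apply: leq_sum.
Qed.

Lemma lexsegment_principal : u = v -> (depth I <= sdepth I)%N.
Proof.
move=> uvE; have wu w : seg w -> w = u.
  case=> _ uw; rewrite -uvE => wu.
  by case: (lex_trichotomy w u) => // /lex_gt_nge.
have [t ut] : exists t, u t != 0%N.
  apply: contrapT => no; move: d_gt0; rewrite -du mdegE big1 // => t _.
  by apply/eqP/negPn/negP=> ut; apply: no; exists t.
have Uu : (U_(t) <= u)%MM by rewrite lep1mP.
apply: (@depth_le_sdepth_one_block _ _ I I_mon u [set t] (u - U_(t))%MM t).
- by apply: lexsegment_threshold => w /wu ->.
- exact: lexsegment_ex.
- by rewrite inE.
- move/lexsegment_deg; rewrite -du -{1}(submK Uu) mdegD mdeg1; lia.
- move=> s; rewrite inE => /eqP ->; exists 1%N; rewrite mulm1n submK //.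
  apply/lexsegment_exps; exists u; split; [by split=> //; left|exact: lepm_refl].
Qed.

(** From here on i is the first index at which u and v differ. *)
Variable i : 'I_n.
Hypothesis agree : forall j, (j < i)%N -> u j = v j.
Hypothesis ltvu : (v i < u i)%N.
Local Notation td := (tail_deg i).

Lemma last_ex : exists z : 'I_n, forall t, (t <= z)%N.
Proof.
have n0 : (0 < n)%N by apply: leq_ltn_trans (ltn_ord i).
have lt : (n.-1 < n)%N by rewrite prednK.
by exists (Ordinal lt) => t; rewrite /= -ltnS prednK.
Qed.

Lemma seg_agree w : seg w -> forall j, (j < i)%N -> w j = u j.
Proof. by case=> _ uw wv; apply: lex_squeeze uw wv agree. Qed.

Lemma seg_bounds w : seg w -> (v i <= w i <= u i)%N.
Proof.
move=> ws; have wu := seg_agree ws; have [_ uw wv] := ws.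
rewrite (lex_ge_at wv) => [|j ji]; last by rewrite wu // agree.
by rewrite (lex_ge_at uw) // => j ji; rewrite wu.
Qed.

Lemma seg_tail w : seg w -> (w i + td w = u i + td u)%N.
Proof.
by move=> ws; apply/mdeg_tail; [exact: seg_agree|case: ws => -> _ _].
Qed.

Lemma seg_intro w : (forall j, (j < i)%N -> w j = u j) -> (w i + td w = u i + td u)%N ->
  lex_ge u w -> lex_ge w v -> seg w.
Proof. by move=> wu dw uw wv; split=> //; rewrite -du; apply/(mdeg_tail wu). Qed.

Lemma lex_ge_v w : (forall j, (j < i)%N -> w j = u j) -> (v i < w i)%N -> lex_ge w v.
Proof. by move=> wu lt; right; exists i; split=> // j ji; rewrite wu // agree. Qed.

Lemma lex_ge_u w : (forall j, (j < i)%N -> w j = u j) -> (w i < u i)%N -> lex_ge u w.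
Proof. by move=> wu lt; right; exists i; split=> // j ji; rewrite wu. Qed.

Let F := (u - U_(i))%MM.

Lemma F_add : (F + U_(i))%MM = u.
Proof. by rewrite submK // lep1mP -lt0n; apply: leq_ltn_trans ltvu. Qed.

Lemma F_notin : ~ U F.
Proof.
move=> /lexsegment_deg; rewrite -du -[in X in (X <= _)%N]F_add mdegD mdeg1; lia.
Qed.

Lemma F_var t : (i <= t)%N -> lex_ge (F + U_(t))%MM v -> U (F + U_(t))%MM.
Proof.
move=> it ge_v; apply/lexsegment_exps; exists (F + U_(t))%MM; split; last exact: lepm_refl.
split=> //; last by rewrite -F_add; apply: lex_ge_var.
by rewrite -du -F_add !mdegD !mdeg1.
Qed.

(** F = u / x_i has degree d - 1, so it is not in I, and F x_t lies between u and
    F x_z for every t after i. *)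
Lemma lexsegment_socle (z : 'I_n) : (forall t, (t <= z)%N) ->
  lex_ge (F + U_(z))%MM v -> (depth I <= sdepth I)%N.
Proof.
move=> zmax Fz.
apply: (@depth_le_sdepth_one_block _ _ I I_mon u [set t : 'I_n | (i <= t)%N] F i).
- apply: lexsegment_threshold => w ws t; rewrite inE -ltnNge; exact: seg_agree.
- exact: lexsegment_ex.
- by rewrite inE.
- exact: F_notin.
- move=> t; rewrite inE => it; exists 1%N; rewrite mulm1n; apply: F_var => //.
  by apply: lex_ge_trans Fz; apply: lex_ge_var.
Qed.

Section NoSocle.
Variable z : 'I_n.
Hypothesis zmax : forall t, (t <= z)%N.
Hypothesis gt_v : lex_gt v (F + U_(z))%MM.

Lemma iz : (i < z)%N.
Proof.
rewrite ltn_neqAle zmax andbT; apply/negP=> /eqP/val_inj izE.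
by apply: (lex_gt_nge gt_v); rewrite -izE F_add.
Qed.

Lemma Fi : F i = v i /\ u i = (v i).+1.
Proof.
suff : u i = (v i).+1 by move=> ui; split=> //; rewrite /F mnmBE mnm1E eqxx ui subn1.
have := @lex_ge_at _ _ _ i (or_intror gt_v).
have iz' : (z == i) = false by rewrite -val_eqE /= gtn_eqF ?iz.
rewrite mnmDE mnm1E iz' addn0 /F mnmBE mnm1E eqxx => H.
suff : (u i - true <= v i)%N by lia.
apply: H => j ji; rewrite mnmDE mnmBE !mnm1E -!val_eqE /= !gtn_eqF //; last first.
  exact: ltn_trans iz.
by rewrite subn0 addn0 agree.
Qed.

(** G divides all the monomials of the segment, and u = G x_i T. The segment has an
    upper part, the monomials G x_i w with w of the degree of T and w <= T, and a lower
    part, the monomials G w with w of one degree more and G w >= v. *)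
Let G : 'X_{1..n} := [multinom if (t < i)%N then u t else if t == i then v i else 0%N | t < n].
Let T : 'X_{1..n} := [multinom if (i < t)%N then u t else 0%N | t < n].

Lemma G_lt j : (j < i)%N -> G j = u j. Proof. by rewrite mnmE => ->. Qed.
Lemma G_i : G i = v i. Proof. by rewrite mnmE ltnn eqxx. Qed.
Lemma G_gt j : (i < j)%N -> G j = 0%N.
Proof. by move=> ij; rewrite mnmE ltnNge ltnW //= -val_eqE /= gtn_eqF. Qed.
Lemma T_le j : (j <= i)%N -> T j = 0%N. Proof. by rewrite mnmE ltnNge => ->. Qed.
Lemma T_gt j : (i < j)%N -> T j = u j. Proof. by rewrite mnmE => ->. Qed.

Lemma uE : (G + U_(i) + T)%MM = u.
Proof.
apply/mnmP=> t; rewrite !mnmDE mnm1E; case: (ltngtP t i) => [ti|it|/val_inj ->].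
- have it : (i == t) = false by rewrite -val_eqE /= gtn_eqF.
  by rewrite (G_lt ti) (T_le (ltnW ti)) it !addn0.
- have ti : (i == t) = false by rewrite -val_eqE /= ltn_eqF.
  by rewrite (G_gt it) (T_gt it) ti.
- by rewrite G_i (T_le (leqnn i)) eqxx addn0 addn1 Fi.2.
Qed.

Lemma FE : F = (G + T)%MM.
Proof. by apply: (@addIm _ U_(i)%MM); rewrite F_add -uE -!addmA (addmC T). Qed.

Lemma td_G : td G = 0%N. Proof. by apply: big1 => t /G_gt. Qed.
Lemma td_u : td u = td T. Proof. by apply: eq_bigr => t /T_gt ->. Qed.

(** Suppose that m enters I along x_i by w1 and along the last variable by w2. Then w1
    is in the upper part, w2 in the lower part, and m has exponent v i at i. If m has
    enough degree after i, exponents of the last variable in w2 can be exchanged for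
    other variables of m, which gives a larger monomial of the segment dividing m.
    Otherwise m and w1 agree after i, so that w2 <= w1 x_z / x_i <= F x_z < v. *)
Lemma lexsegment_ray m : ~ U m -> exists t, t \in [set i; z] /\
  forall e, ~ U (m + U_(t) *+ e)%MM.
Proof.
move=> nU; apply: contrapT => no.
have [a Ua] : exists a, U (m + U_(i) *+ a)%MM.
  apply: contrapT => na; apply: no; exists i; rewrite !inE eqxx; split=> // e Ue.
  by apply: na; exists e.
have [b Ub] : exists b, U (m + U_(z) *+ b)%MM.
  apply: contrapT => nb; apply: no; exists z; rewrite !inE eqxx orbT; split=> // e Ue.
  by apply: nb; exists e.
have notle w : seg w -> exists t, (m t < w t)%N.
  move=> ws; apply: contrapT => nlt; apply: nU; apply/lexsegment_exps; exists w.
  split=> //; apply/mnm_lepP=> t; rewrite leqNgt; apply/negP=> lt; apply: nlt; by exists t.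
have [w1 [s1 /mnm_lepP le1]] := (lexsegment_exps _).1 Ua.
have [w2 [s2 /mnm_lepP le2]] := (lexsegment_exps _).1 Ub.
have le1' t : t != i -> (w1 t <= m t)%N.
  by move=> ti; have := le1 t; rewrite mnmDE mulmnE mnm1E eq_sym (negPf ti) addn0.
have le2' t : t != z -> (w2 t <= m t)%N.
  by move=> tz; have := le2 t; rewrite mnmDE mulmnE mnm1E eq_sym (negPf tz) addn0.
have [t1 lt1] := notle w1 s1.
have t1i : t1 = i by apply/eqP; apply: contraTT lt1 => /le1'; rewrite -leqNgt.
subst t1; have iz' : i != z by rewrite -val_eqE /= ltn_eqF ?iz.
have [_ ui] := Fi; have /andP[_ w1u] := seg_bounds s1; have /andP[w2v _] := seg_bounds s2.
have w2m := le2' i iz'.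
have [w1i w2i] : w1 i = u i /\ w2 i = v i by lia.
have td1 := seg_tail s1; have td2 := seg_tail s2.
have tdm : (td w1 <= td m)%N.
  by apply: tail_deg_le => t it; apply: le1'; rewrite -val_eqE /= gtn_eqF.
have [ltm|gem] := leqP (td u).+1 (td m).
  pose q : 'X_{1..n} := [multinom if (t <= i)%N then w2 t else minn (w2 t) (m t) | t < n].
  pose M : 'X_{1..n} := [multinom if (t <= i)%N then w2 t else m t | t < n].
  have qM : (q <= M)%MM by apply/mnm_lepP=> t; rewrite !mnmE; case: ifP => _; lia.
  have [w2d _ w2v'] := s2.
  have [|w3 [/mnm_lepP qw3 /mnm_lepP w3M dw3]] := @monomial_between _ q M d qM.
    apply/andP; split.
      rewrite -w2d !mdegE; apply: leq_sum => t _; rewrite mnmE; case: ifP => _; lia.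
    have tdM : td M = td m.
      by apply: eq_bigr => t it; rewrite mnmE ifN // -ltnNge.
    have Mi : M i = w2 i by rewrite mnmE leqnn.
    rewrite -w2d (mdeg_split i w2) (mdeg_split i M) tdM Mi.
    rewrite [X in (_ <= X + _)%N](eq_bigr w2) => [|t ti]; last by rewrite mnmE ltnW.
    rewrite leq_add2l leq_add2l; lia.
  have w3E t : (t <= i)%N -> w3 t = w2 t.
    by move=> ti; have := qw3 t; have := w3M t; rewrite !mnmE ti; lia.
  apply: nU; apply/lexsegment_exps; exists w3; split.
    have w3u j : (j < i)%N -> w3 j = u j by move=> ji; rewrite w3E ?(ltnW ji) // (seg_agree s2).
    split=> //; first by apply: lex_ge_u => //; rewrite w3E // w2i.
    apply: lex_ge_trans w2v'; apply: (lex_ge_last zmax); first by rewrite dw3.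
    move=> t tz; case: (leqP t i) => [/w3E -> //|it]; have := qw3 t.
    by rewrite mnmE ifN -?ltnNge //; have := le2' t tz; lia.
  apply/mnm_lepP=> t; have := w3M t; rewrite mnmE; case: ifP => // ti.
  by move=> /leq_trans; apply; apply: le2'; rewrite -val_eqE /= ltn_eqF // (leq_ltn_trans ti) ?iz.
have w1m t : (i < t)%N -> w1 t = m t.
  move=> it; apply/eqP; rewrite eqn_leq le1' -?val_eqE /= ?gtn_eqF //.
  have : (\sum_(s : 'I_n | (i < s)%N) (m s - w1 s) = 0)%N.
    have : (td w1 + \sum_(s : 'I_n | (i < s)%N) (m s - w1 s) = td m)%N.
      rewrite -big_split; apply: eq_bigr => s si /=; rewrite subnKC // le1' //.
      by rewrite -val_eqE /= gtn_eqF.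
    lia.
  by move/eqP; rewrite sum_nat_eq0 => /forall_inP/(_ t it); rewrite subn_eq0.
have [w2d _ w2v'] := s2; have [w1d uw1 _] := s1.
have Uw1 : (U_(i) <= w1)%MM by rewrite lep1mP w1i -lt0n (leq_ltn_trans _ ltvu).
pose w1' := (w1 - U_(i))%MM.
have w1E : (w1' + U_(i))%MM = w1 by rewrite submK.
have ge_w1 : lex_ge F w1'.
  case: (lex_trichotomy F w1') => [->|?|w1F]; [by left|by right|].
  case: (lex_gt_nge _ uw1); rewrite -w1E -F_add.
  case: w1F => [s [sE lts]]; exists s; split=> [j /sE|]; rewrite !mnmDE ?ltn_add2r // => ->//.
apply: (lex_gt_nge gt_v); apply: lex_ge_trans (lex_ge_add U_(z)%MM ge_w1) _.
apply: lex_ge_trans w2v'; apply: (lex_ge_last zmax).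
  by rewrite w2d -w1d -w1E !mdegD !mdeg1.
move=> t tz; rewrite mnmDE mnm1E eq_sym (negPf tz) addn0 mnmBE mnm1E.
case: (ltngtP t i) => [ti|it|/val_inj ->].
- by rewrite -val_eqE /= gtn_eqF // subn0 (seg_agree s1) // (seg_agree s2).
- by rewrite -val_eqE /= ltn_eqF // subn0 w1m // le2'.
- by rewrite eqxx w1i w2i; lia.
Qed.

Lemma v_seg : seg v. Proof. by split=> //; left. Qed.

Lemma v_tail : td v = (td T).+1.
Proof. by have := seg_tail v_seg; rewrite Fi.2 td_u; lia. Qed.

(** In this case I is G times the ideal generated by the variables x_i, ..., x_l, for
    an index l after i. *)
Lemma lexsegment_linear : td T = 0%N -> (depth I <= sdepth I)%N.
Proof.
move=> tdT; have T0 t : T t = 0%N.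
  by case: (leqP t i) => [/T_le //|it]; apply: tail_deg_eq0 tdT it.
have FG : F = G by rewrite FE; apply/mnmP=> t; rewrite mnmDE T0 addn0.
have [l [il vl]] : exists l, (i < l)%N /\ v l != 0%N.
  apply: contrapT => no; have := v_tail; rewrite tdT /tail_deg big1 // => t it.
  by apply/eqP; apply: contrapT => /negP vt; apply: no; exists t.
have vl1 : v l = 1%N by have := tail_deg_ge1 v il; rewrite v_tail tdT; lia.
have v0 t : (i < t)%N -> t != l -> v t = 0%N.
  by move=> it tl; have := tail_deg_ge2 v it il tl; rewrite v_tail tdT vl1; lia.
have vE : v = (G + U_(l))%MM.
  apply/mnmP=> t; rewrite mnmDE mnm1E eq_sym.
  case: (ltngtP t i) => [ti|it|/val_inj ->].
  - by rewrite G_lt // -agree // -val_eqE /= ltn_eqF ?addn0 // (ltn_trans ti).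
  - by rewrite G_gt //; case: eqVneq => [->|] //; apply: v0.
  - by rewrite G_i -val_eqE /= ltn_eqF ?addn0.
pose W := [set t : 'I_n | (i <= t)%N && (t <= l)%N].
pose g : 'X_{1..n} := [multinom if (t < i)%N then u t else 0%N | t < n].
apply: (@depth_le_sdepth_one_block _ _ I I_mon g W F i).
- apply: lexsegment_threshold => w ws t; rewrite inE negb_and -!ltnNge mnmE.
  case: (ltnP t i) => [ti _|it /= lt]; first by rewrite (seg_agree ws).
  have lt_it := ltn_trans il lt.
  have := seg_tail ws; have /andP[wv wu] := seg_bounds ws; rewrite Fi.2 td_u tdT => wd.
  apply/eqP; rewrite -leqn0 leqNgt; apply/negP=> wt.
  have wt1 := tail_deg_ge1 w lt_it; have wi : w i = v i by rewrite Fi.2 in wu; lia.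
  have wtl : t != l by rewrite -val_eqE /= gtn_eqF.
  have wl0 : w l = 0%N by have := tail_deg_ge2 w lt_it il wtl; lia.
  have [_ _ wv'] := ws; suff : (v l <= w l)%N by rewrite vl1 wl0.
  apply: (lex_ge_at wv') => j jl; case: (ltngtP j i) => [ji|ij|/val_inj -> //].
    by rewrite (seg_agree ws) // agree.
  have jt : j != t by rewrite -val_eqE /= ltn_eqF // (ltn_trans jl).
  have jl' : j != l by rewrite -val_eqE /= ltn_eqF.
  by rewrite v0 //; have := tail_deg_ge2 w ij lt_it jt; lia.
- exact: lexsegment_ex.
- by rewrite inE leqnn ltnW.
- exact: F_notin.
- move=> t; rewrite inE => /andP[it tl]; exists 1%N; rewrite mulm1n; apply: F_var => //.
  by rewrite FG vE; apply: lex_ge_var.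
Qed.

Lemma seg_hi w : (forall j, (j <= i)%N -> w j = 0%N) -> td w = td T -> lex_ge T w ->
  seg (G + U_(i) + w)%MM.
Proof.
move=> w0 tdw Tw; have wi : (G + U_(i) + w)%MM i = u i.
  by rewrite !mnmDE G_i mnm1E eqxx w0 // Fi.2; lia.
have wj j : (j < i)%N -> (G + U_(i) + w)%MM j = u j.
  move=> ji; have ij : (i == j) = false by rewrite -val_eqE /= gtn_eqF.
  by rewrite !mnmDE (G_lt ji) mnm1E ij w0 ?(ltnW ji) // !addn0.
apply: seg_intro => //.
- by rewrite wi !tail_degD tail_deg_var ltnn td_G tdw td_u.
- by rewrite -uE addmC [X in lex_ge _ X]addmC; apply: lex_ge_add.
- by apply: lex_ge_v => //; rewrite wi.
Qed.

Lemma seg_lo w : (forall j, (j <= i)%N -> w j = 0%N) -> td w = (td T).+1 ->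
  lex_ge (G + w)%MM v -> seg (G + w)%MM.
Proof.
move=> w0 tdw wv; have wi : (G + w)%MM i = v i by rewrite !mnmDE G_i w0 // addn0.
have wj j : (j < i)%N -> (G + w)%MM j = u j.
  by move=> ji; rewrite !mnmDE (G_lt ji) w0 ?addn0 // ltnW.
apply: seg_intro => //.
- by rewrite wi tail_degD td_G tdw td_u Fi.2; lia.
- by apply: lex_ge_u => //; rewrite wi.
Qed.

Lemma lexsegment_two_blocks g W H : i \in W -> z \in W ->
  (forall w, seg w -> forall t, t \notin W -> w t = g t) ->
  (forall t, t \in W -> t != i -> exists w N, seg w /\
     (w <= H + U_(i) *+ N + U_(t) *+ N)%MM) ->
  (forall w, seg w -> exists2 t, t != i & (H t < w t)%N) ->
  (depth I <= sdepth I)%N.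
Proof.
move=> iW zW thr HU nH; have iz' : i != z by rewrite -val_eqE /= ltn_eqF ?iz.
apply: (@depth_le_sdepth_two_blocks _ _ I I_mon g W i z H) => //.
- exact: lexsegment_threshold.
- exact: lexsegment_ex.
- move=> m /lexsegment_ray[t [tiz ray]]; exists t; split=> //.
  by move: tiz; rewrite !inE => /orP[]/eqP ->.
- move=> t tW ti; have [w [N [ws wH]]] := HU t tW ti.
  by exists N; apply/lexsegment_exps; exists w.
- move=> N /lexsegment_exps[w [/nH[t ti lt] /mnm_lepP/(_ t)]].
  by rewrite mnmDE mulmnE mnm1E eq_sym (negPf ti) addn0 leqNgt lt.
Qed.

(** Here x_k is the first variable of T, and p is the index following i. Below, H is
    a monomial such that H x_i^N x_t^N is in I for all t in W other than i, and
    H x_i^N is not. *)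
Variables (k p : 'I_n) (T' : 'X_{1..n}).
Hypothesis p_succ : p = i.+1 :> nat.
Hypothesis ik : (i < k)%N.
Hypothesis kmin : forall t, (t < k)%N -> T t = 0%N.
Hypothesis TE : T = (T' + U_(k))%MM.

Let e := td T.

Lemma T'_le t : (T' t <= T t)%N. Proof. by rewrite TE mnmDE leq_addr. Qed.

Lemma T'0 t : (t <= i)%N -> T' t = 0%N.
Proof. by move=> ti; have := T'_le t; rewrite T_le //; lia. Qed.

Lemma td_T' : (td T').+1 = e.
Proof. by rewrite /e TE tail_degD tail_deg_var ik addn1. Qed.

Lemma ip : (i < p)%N. Proof. by rewrite p_succ. Qed.

Lemma ne_i t : (i < t)%N -> (i == t) = false /\ (t == i) = false.
Proof. by move=> it; rewrite -!val_eqE /= ltn_eqF ?gtn_eqF. Qed.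

Lemma seg_swap t : (k <= t)%N -> seg (G + U_(i) + (T' + U_(t)))%MM.
Proof.
move=> kt; have it : (i < t)%N by apply: leq_trans ik kt.
apply: seg_hi => [j ji||]; last by rewrite TE; apply: lex_ge_var.
  rewrite mnmDE T'0 // mnm1E; case: eqVneq => // tj.
  by move: ji; rewrite -tj leqNgt it.
by rewrite tail_degD tail_deg_var it addn1 td_T'.
Qed.

Let W0 := [set t : 'I_n | (i <= t)%N].

Lemma W0_lt t : t \in W0 -> t != i -> (i < t)%N.
Proof. by rewrite inE ltn_neqAle => -> ti; rewrite andbT; apply: contra ti => /eqP/val_inj ->. Qed.

Lemma thr0 w : seg w -> forall t, t \notin W0 -> w t = u t.
Proof. by move=> ws t; rewrite inE -ltnNge; apply: seg_agree. Qed.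

(** H = G T / x_k: after i it has one degree less than needed for the upper part. *)
Lemma lexsegment_adjacent : k = p -> (depth I <= sdepth I)%N.
Proof.
move=> kp; apply: (@lexsegment_two_blocks u W0 (G + T')%MM).
- by rewrite inE.
- by rewrite inE ltnW ?iz.
- exact: thr0.
- move=> t tW ti; exists (G + U_(i) + (T' + U_(t)))%MM, 1%N; split.
    by apply: seg_swap; rewrite kp p_succ; apply: W0_lt.
  apply/mnm_lepP=> s; rewrite !mnmDE !mulm1n; lia.
- move=> w ws; apply: contrapT => no.
  have le : (td w <= td (G + T'))%N.
    apply: tail_deg_le => t it; rewrite leqNgt; apply/negP=> lt.
    by apply: no; exists t => //; case: (ne_i it) => _ ->.
  have := seg_tail ws; have /andP[_] := seg_bounds ws.
  by move: le; rewrite tail_degD td_G td_u -/e -td_T'; lia.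
Qed.

Hypothesis pk : (p < k)%N.

Lemma e_gt0 : (0 < e)%N. Proof. by rewrite -td_T'. Qed.

(** The first candidates for the lower part in decreasing order: X p, then the X s for
    s after p. *)
Let X s := (G + U_(p) *+ e + U_(s))%MM.

Lemma X_gt s t : (i < t)%N -> X s t = ((p == t) * e + (s == t))%N.
Proof. by move=> it; rewrite !mnmDE G_gt // mulmnE !mnm1E. Qed.

Lemma X_le s t : (i < s)%N -> (t <= i)%N -> X s t = G t.
Proof.
move=> si ti; have pt : (p == t) = false by rewrite -val_eqE /= gtn_eqF // p_succ.
have st : (s == t) = false by rewrite -val_eqE /= gtn_eqF // (leq_ltn_trans ti).
by rewrite !mnmDE mulmnE !mnm1E pt st !addn0.
Qed.

Lemma seg_X s : (i < s)%N -> lex_ge (X s) v -> seg (X s).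
Proof.
move=> si; rewrite /X -addmA => Xv; apply: seg_lo => // [j ji|].
  have pj : (p == j) = false by rewrite -val_eqE /= gtn_eqF // p_succ.
  have sj : (s == j) = false by rewrite -val_eqE /= gtn_eqF // (leq_ltn_trans ji).
  by rewrite mnmDE mulmnE !mnm1E pj sj.
by rewrite tail_degD tail_degMn !tail_deg_var ip si mul1n addn1.
Qed.

Lemma seg_lo_tail w : seg w -> w i = v i -> td w = e.+1.
Proof. by move=> /seg_tail; rewrite Fi.2 td_u -/e; lia. Qed.

Lemma seg_hi_tail w : seg w -> w i = u i -> td w = e.
Proof. by move=> /seg_tail; rewrite td_u -/e; lia. Qed.

Lemma seg_cases w : seg w -> w i = v i \/ w i = u i.
Proof. by move=> /seg_bounds; rewrite Fi.2; lia. Qed.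

(* for w in the upper part, the exponents between i and k vanish *)
Lemma seg_hi_zero w t : seg w -> w i = u i -> (i < t)%N -> (t < k)%N -> w t = 0%N.
Proof.
move=> ws wi it tk; have [_ uw _] := ws.
rewrite (lex_ge_agree uw (k := k)) //; first by have := kmin tk; rewrite T_gt.
move=> j jk; case: (ltngtP j i) => [ji|ij|/val_inj ->]; rewrite ?wi //.
  by rewrite (seg_agree ws).
by have := kmin jk; rewrite T_gt // => ->.
Qed.

Lemma seg_above_X w s : seg w -> w i = v i -> (p < s)%N -> lex_gt w (X s) ->
  (e < w p)%N \/ w p = e /\ exists j, [/\ (p < j)%N, (j < s)%N & (0 < w j)%N].
Proof.
move=> ws wi ps [j [jE ltj]]; have is_ := ltn_trans ip ps.
have wd := seg_lo_tail ws wi.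
have ps' : (s == p) = false by rewrite -val_eqE /= gtn_eqF.
have Xp : X s p = e by rewrite X_gt ?ip // eqxx mul1n ps' addn0.
case: (ltngtP j i) => [ji|ij|/val_inj ij].
- by move: ltj; rewrite X_le ?(ltnW ji) // G_lt // (seg_agree ws) // ltnn.
- case: (ltngtP j p) => [|pj|/val_inj jp]; first by rewrite p_succ ltnS leqNgt ij.
    have wp : w p = e by rewrite jE.
    have pj' : (p == j) = false by rewrite -val_eqE /= ltn_eqF.
    have pj'' : p != j by rewrite pj'.
    case: (ltngtP j s) => [js|sj|/val_inj js].
    + by right; split=> //; exists j; split=> //; apply: leq_ltn_trans ltj.
    + have sj' : (s == j) = false by rewrite -val_eqE /= ltn_eqF.
      have wsE : w s = 1%N by rewrite jE // X_gt // eqxx eq_sym ps'.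
      have := @tail_deg_ge3 _ i w p s j ip is_ ij; rewrite eq_sym ps' pj' sj'.
      by move=> /(_ isT isT isT); rewrite wd wp wsE; lia.
    + have := @tail_deg_ge2 _ i w p j ip ij pj''; rewrite wd wp.
      by move: ltj; rewrite js X_gt // eqxx; lia.
  by left; move: ltj; rewrite jp Xp.
- by move: ltj; rewrite ij X_le // G_i wi ltnn.
Qed.

Lemma v_not_above_Xp : ~ lex_gt v (X p).
Proof.
move=> [j [jE ltj]]; have vd : td v = e.+1 by apply: v_tail.
have Xp : X p p = e.+1 by rewrite X_gt ?ip // eqxx mul1n addn1.
case: (ltngtP j i) => [ji|ij|/val_inj ij].
- by move: ltj; rewrite X_le ?ip ?(ltnW ji) // G_lt // agree // ltnn.
- case: (ltngtP j p) => [|pj|/val_inj jp]; first by rewrite p_succ ltnS leqNgt ij.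
    have pj' : p != j by rewrite -val_eqE /= ltn_eqF.
    by have := @tail_deg_ge2 _ i v p j ip ij pj'; rewrite vd (jE p) // Xp; lia.
  by have := @tail_deg_ge1 _ i v p ip; move: ltj; rewrite jp Xp vd; lia.
- by move: ltj; rewrite ij X_le ?ip // G_i ltnn.
Qed.

(** H = G x_p^e. For t up to k, H x_t is in the lower part; for t after k, G x_i x_t^e
    is in the upper part and divides H x_i^e x_t^e. *)
Lemma lexsegment_high : lex_ge (X k) v -> (depth I <= sdepth I)%N.
Proof.
move=> Xk; apply: (@lexsegment_two_blocks u W0 (G + U_(p) *+ e)%MM).
- by rewrite inE.
- by rewrite inE ltnW ?iz.
- exact: thr0.
- move=> t tW ti; have it := W0_lt tW ti; case: (leqP t k) => tk.
    exists (X t), 1%N; split.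
      by apply: seg_X => //; apply: lex_ge_trans Xk; apply: lex_ge_var.
    by apply/mnm_lepP=> s; rewrite /X !mnmDE !mulm1n; lia.
  exists (G + U_(i) + U_(t) *+ e)%MM, e; split.
    apply: seg_hi => [j ji||].
    + have tj : (t == j) = false by rewrite -val_eqE /= gtn_eqF // (leq_ltn_trans ji).
      by rewrite mulmnE mnm1E tj.
    + by rewrite tail_degMn tail_deg_var it mul1n.
    + right; exists k; have tj j : (j <= k)%N -> (t == j) = false.
        by move=> jk; rewrite -val_eqE /= gtn_eqF // (leq_ltn_trans jk).
      split=> [j jk|]; first by rewrite kmin // mulmnE mnm1E tj // ltnW.
      by rewrite mulmnE mnm1E tj // TE mnmDE mnm1E eqxx addn1.
  apply/mnm_lepP=> s; rewrite !mnmDE !mulmnE mnm1E; have := e_gt0.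
  by case: (i == s) => /=; nia.
- move=> w ws; apply: contrapT => no.
  have le t : (i < t)%N -> (w t <= (p == t) * e)%N.
    move=> it; rewrite leqNgt; apply/negP=> lt; apply: no; exists t.
      by case: (ne_i it) => _ ->.
    by rewrite mnmDE G_gt // mulmnE mnm1E.
  have led : (td w <= w p)%N.
    rewrite /tail_deg (bigD1 p) ?ip //= big1 ?addn0 // => t /andP[it tp].
    by have := le t it; rewrite eq_sym (negPf tp) mul0n leqn0 => /eqP.
  have wpe := le p ip; rewrite eqxx mul1n in wpe.
  case: (seg_cases ws) => wi; first by have := seg_lo_tail ws wi; lia.
  have := seg_hi_zero ws wi ip pk; have := seg_hi_tail ws wi; have := e_gt0; lia.
Qed.

(** Now v exceeds X k, so the lower part stops before x_k, and the variables between i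
    and k whose X t is below v occur in no generator: they are left out of W. For
    H = G x_p^e T / x_k and t in W, the product H x_i x_t is divisible by X t if t is
    before k, and by u x_t / x_k in the upper part otherwise. *)
Lemma lexsegment_low : lex_gt v (X k) -> (depth I <= sdepth I)%N.
Proof.
move=> vX.
pose W := [set t : 'I_n | (i <= t)%N && ~~ [&& (i < t)%N, (t < k)%N & `[< lex_gt v (X t) >]]].
pose g : 'X_{1..n} := [multinom if (t < i)%N then u t else 0%N | t < n].
pose H := (G + U_(p) *+ e + T')%MM.
have HE t : (i < t)%N -> H t = ((p == t) * e + T' t)%N.
  by move=> it; rewrite !mnmDE G_gt // mulmnE mnm1E.
have T'k t : (t < k)%N -> T' t = 0%N by move=> /kmin; have := T'_le t; lia.
apply: (@lexsegment_two_blocks g W H).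
- by rewrite inE leqnn ltnn.
- have zk : (z < k)%N = false by rewrite ltnNge zmax.
  by rewrite inE zk /= andbF andbT; apply: ltnW iz.
- move=> w ws t; rewrite inE negb_and -ltnNge negbK mnmE => /orP[ti|].
    by rewrite ti (seg_agree ws).
  move=> /and3P[it tk /asboolP vXt]; rewrite ltnNge ltnW //=.
  case: (seg_cases ws) => wi; last exact: seg_hi_zero ws wi it tk.
  have pt : (p < t)%N.
    rewrite ltn_neqAle p_succ it andbT -p_succ; apply/eqP=> /val_inj pt.
    by apply: v_not_above_Xp; rewrite pt.
  have [_ _ wv] := ws; have wd := seg_lo_tail ws wi.
  have neq (a b : 'I_n) : (a < b)%N -> a != b by move=> ab; rewrite -val_eqE /= ltn_eqF.
  case: (seg_above_X ws wi pt (lex_ge_gt_trans wv vXt)) => [wp|[wp [j [pj jt wj]]]].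
    by have := @tail_deg_ge2 _ i w p t ip it (neq _ _ pt); rewrite wd; lia.
  have := @tail_deg_ge3 _ i w p j t ip (ltn_trans ip pj) it (neq _ _ pj) (neq _ _ pt) (neq _ _ jt).
  by rewrite wd wp; lia.
- move=> t; rewrite inE => /andP[it0 nt] ti; have it : (i < t)%N.
    by rewrite ltn_neqAle it0 andbT; apply: contra ti => /eqP/val_inj ->.
  case: (leqP k t) => kt.
    exists (G + U_(i) + (T' + U_(t)))%MM, 1%N; split; first exact: seg_swap.
    by apply/mnm_lepP=> s; rewrite /H !mnmDE !mulm1n; lia.
  exists (X t), 1%N; split; last first.
    by apply/mnm_lepP=> s; rewrite /H /X !mnmDE !mulm1n; lia.
  apply: seg_X => //; apply: contrapT => /lex_ge_gt vXt.
  by move: nt; rewrite it kt /=; case/negP; apply/asboolP.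
- move=> w ws; apply: contrapT => no.
  have le t : (i < t)%N -> (w t <= H t)%N.
    move=> it; rewrite leqNgt; apply/negP=> lt; apply: no; exists t => //.
    by case: (ne_i it) => _ ->.
  case: (seg_cases ws) => wi.
    have [_ _ wv] := ws.
    case: (seg_above_X ws wi pk (lex_ge_gt_trans wv vX)) => [wp|[_ [j [pj jk wj]]]].
      by have := le p ip; rewrite HE ?ip // eqxx mul1n T'k // addn0 leqNgt wp.
    have pj' : (p == j) = false by rewrite -val_eqE /= ltn_eqF.
    have ij := ltn_trans ip pj.
    by have := le j ij; rewrite HE // pj' mul0n T'k // leqNgt wj.
  have : (td w <= td T')%N.
    apply: tail_deg_le => t it; have [<-|pt] := eqVneq p t.
      by rewrite (seg_hi_zero ws wi ip pk).
    by have := le t it; rewrite HE // (negPf pt).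
  by rewrite (seg_hi_tail ws wi) -td_T' ltnn.
Qed.

Lemma lexsegment_tail : (depth I <= sdepth I)%N.
Proof.
have [Xk|/lex_ge_gt] := pselect (lex_ge (X k) v); first exact: lexsegment_high.
exact: lexsegment_low.
Qed.

End NoSocle.

Lemma lexsegment_differ : (depth I <= sdepth I)%N.
Proof.
have [z zmax] := last_ex.
have [/(lexsegment_socle zmax)//|/lex_ge_gt gt_v] := pselect (lex_ge (F + U_(z))%MM v).
pose T : 'X_{1..n} := [multinom if (i < t)%N then u t else 0%N | t < n].
have [T0|Tn0] := eqVneq (td T) 0%N; first exact: (lexsegment_linear zmax gt_v T0).
have [t0 Tt0] : exists t, T t != 0%N.
  apply: contrapT => no; case/eqP: Tn0; rewrite /tail_deg big1 // => t _.
  by apply/eqP; apply: contrapT => /negP Tt; apply: no; exists t.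
case: (@arg_minnP _ t0 (fun t => T t != 0%N) (@nat_of_ord n) Tt0) => k Tk kmin'.
have kmin t : (t < k)%N -> T t = 0%N.
  by move=> tk; apply/eqP; apply: contraTT tk => /kmin'; rewrite -leqNgt.
have ik : (i < k)%N by move: Tk; rewrite mnmE; case: ifP.
have pn : (i.+1 < n)%N by apply: leq_ltn_trans ik (ltn_ord k).
have TE : T = (T - U_(k) + U_(k))%MM by rewrite submK // lep1mP.
have [pk|kp] := ltnP i.+1 k.
  exact: (@lexsegment_tail z zmax gt_v k (Ordinal pn) _ erefl ik kmin TE pk).
apply: (@lexsegment_adjacent z zmax gt_v k (Ordinal pn) _ erefl ik TE).
by apply/val_inj/eqP; rewrite /= eqn_leq kp.
Qed.

End Lexsegment.

Theorem depth_le_sdepth_lexsegment (K : fieldType) (n : nat) (I : set {mpoly K[n]}) :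
  lexsegment_ideal I -> (depth I <= sdepth I)%N.
Proof.
move=> [d [u [v [d2 du dv uv IE]]]]; have d0 := ltnW d2.
case: (uv) => [|[i [agree ltvu]]]; first exact: (lexsegment_principal d0 du dv uv IE).
exact: (lexsegment_differ d0 du dv uv IE agree ltvu).
Qed.

Theorem theorem2p1 (K : fieldType) (n : nat) (I : set {mpoly K[n]})
    (I_monomial : monomial_ideal I)
    (I_neq0 : I <> [set 0%R]%classic)
    (I_proper : I <> [set: {mpoly K[n]}]%classic)
    (s : nat) (P : 'I_s -> set {mpoly K[n]})
    (P_inj : injective P)
    (AssE : Ass I = range P) :
  (forall i : 'I_s, ~ (P i `<=` ideal_sum (fun j => j != i) P)%classic)
    \/ bigsize I = 1%N
    \/ lexsegment_ideal I ->
  (depth I <= sdepth I)%N.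
Proof.
case=> [|[]].
- exact: depth_le_sdepth_private I_monomial I_neq0 AssE.
- exact: depth_le_sdepth_bigsize I_monomial I_neq0 I_proper.
- exact: depth_le_sdepth_lexsegment.
Qed.
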